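(* Let $\chi\ne\chi^0$ be a primitive Dirichlet character modulo $f_\chi$, let $r$ be a positive integer, let $b>0$ be real and let $\epsilon\in\{1,2\}$. For $\theta>0$ set $$G_{\epsilon,\chi}(\theta,b,r)=r\sum_{n=0}^\infty(-1)^{\epsilon n}\chi(n)e^{-(n+b/r)^r\theta},$$ and let $L_{r,\epsilon}(s,b;\chi)$ be the (analytic continuation to $s\in\mathbb C$ of the) $L$-series $$L_{r,\epsilon}(s,b;\chi)=r\sum_{m=0}^\infty\frac{(-1)^{\epsilon m}\chi(m)}{(m+b/r)^{s}}.$$ Then $$G_{\epsilon,\chi}(\theta,b,r)\sim\sum_{n=0}^\infty\frac{(-1)^n}{n!}\,L_{r,\epsilon}(-rn,b;\chi)\,\theta^n\qquad\text{as }\theta\to 0^+.$$ Furthermore, if $0<b<r$, then for every nonnegative integer $n$, $$L_{r,\epsilon}(-rn,b;\chi)=\begin{cases}\dfrac r2\,E_{rn,\bar\chi}\left(\dfrac br\right) &\text{if }\epsilon=1\text{ and }f_\chi\text{ is odd},\\[2mm] -r\,\dfrac{B_{rn+1,\bar\chi}\left(\frac br\right)}{rn+1} &\text{if }\epsilon=2.\end{cases}$$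
   Context: The principal character $\chi^0$ is the one with conductor $1$, i.e. $\chi^0(m)=1$ for all integers $m$. A primitive character $\chi$ modulo $f_\chi$ is regarded as a function on $\mathbb Z$, periodic mod $f_\chi$ and zero on integers not coprime to $f_\chi$; $\bar\chi$ is its complex conjugate. The series defining $L_{r,\epsilon}(s,b;\chi)$ converges absolutely for $\mathrm{Re}(s)>1$; its values at $s=-rn$ are those of its analytic continuation. For a primitive character $\chi$ modulo $f_\chi$, the generalized Bernoulli polynomials $B_{n,\chi}(x)$ are defined by (note the conjugate) $$\sum_{m=0}^{f_\chi-1}\frac{\bar\chi(m)\,t\,e^{(m+x)t}}{e^{f_\chi t}-1}=\sum_{n=0}^\infty B_{n,\chi}(x)\frac{t^n}{n!}\qquad(|t|<2\pi/f_\chi),$$ and, when $f_\chi>1$ is odd, the generalized Euler polynomials $E_{n,\chi}(x)$ are defined by $$\sum_{m=0}^{f_\chi-1}\frac{2(-1)^m\bar\chi(m)\,e^{(m+x)t}}{e^{f_\chi t}+1}=\sum_{n=0}^\infty E_{n,\chi}(x)\frac{t^n}{n!}\qquad(|t|<\pi/f_\chi).$$ Thus $B_{n,\bar\chi}(x)$ and $E_{n,\bar\chi}(x)$ are given by the same generating functions with $\chi(m)$ in place of $\bar\chi(m)$. The notation $F(\theta)\sim\sum_{n\ge0}\gamma_n\theta^n$ as $\theta\to0^+$ means that $F(\theta)=\sum_{n=0}^{N}\gamma_n\theta^n+O(\theta^{N+1})$ as $\theta\to0^+$ for every nonnegative integer $N$. *)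

(* Defs.v *)
From Stdlib Require Import Reals ZArith Arith.
From Coquelicot Require Import Coquelicot.

Open Scope R_scope.

(** Complex analysis *)

(* Coquelicot has neither a complex exponential nor a sum operator for
   complex series. *)
Definition Cexp (z : C) : C :=
  (exp (Re z) * cos (Im z), exp (Re z) * sin (Im z)).

(* [x ^ s] for real [x > 0], with the real logarithm. *)
Definition Cpow_pos (x : R) (s : C) : C := Cexp (Cmult s (RtoC (ln x))).

(* Meaningful when both component series converge. *)
Definition CSeries (a : nat -> C) : C :=
  (Series (fun n => Re (a n)), Series (fun n => Im (a n))).

Definition analytic_at (L : C -> C) (z0 : C) : Prop :=
  exists (a : nat -> C) (rho : R), 0 < rho /\
    forall z : C, Cmod (Cminus z z0) < rho ->
      is_pseries (K := C_AbsRing) (V := C_NormedModule) a (Cminus z z0) (L z).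

Definition entire (L : C -> C) : Prop := forall z0 : C, analytic_at L z0.

Definition asymptotic_expansion (F : R -> C) (gamma : nat -> C) : Prop :=
  forall N : nat, exists M : R,
    at_right 0 (fun theta =>
      Cmod (Cminus (F theta)
              (sum_n (fun n => Cmult (gamma n) (RtoC (theta ^ n))) N))
      <= M * theta ^ (S N)).

(** Dirichlet characters, as functions on the integers *)

Record dirichlet_character (f : nat) (chi : Z -> C) : Prop := {
  dc_modulus_pos : (0 < f)%nat;
  dc_periodic : forall m : Z, chi (m + Z.of_nat f)%Z = chi m;
  dc_mult : forall m n : Z, chi (m * n)%Z = Cmult (chi m) (chi n);
  dc_support : forall m : Z, chi m <> RtoC 0 <-> Z.gcd m (Z.of_nat f) = 1%Z
}.

(* Not induced by a character whose modulus is a proper divisor of [f]. *)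
Definition primitive_character (f : nat) (chi : Z -> C) : Prop :=
  dirichlet_character f chi /\
  forall (d : nat) (psi : Z -> C),
    Nat.divide d f -> dirichlet_character d psi ->
    (forall m : Z, Z.gcd m (Z.of_nat f) = 1%Z -> chi m = psi m) ->
    d = f.

Definition principal_character : Z -> C := fun _ => RtoC 1.

Definition conj_character (chi : Z -> C) : Z -> C := fun m => Cconj (chi m).

(** Generalized Bernoulli and Euler polynomials *)

(* [t = 0] is excluded in the Bernoulli case: it is a removable singularity
   of the generating function. *)
Definition is_gen_bernoulli (f : nat) (chi : Z -> C) (B : nat -> R -> C)
  : Prop :=
  forall (x : R) (t : C),
    0 < Cmod t < 2 * PI / INR f ->
    is_pseries (K := C_AbsRing) (V := C_NormedModule)
      (fun n => Cdiv (B n x) (RtoC (INR (fact n)))) t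
      (sum_n (fun m : nat =>
         Cdiv (Cmult (Cmult (Cconj (chi (Z.of_nat m))) t)
                     (Cexp (Cmult (RtoC (INR m + x)) t)))
              (Cminus (Cexp (Cmult (RtoC (INR f)) t)) (RtoC 1)))
         (f - 1)).

Definition is_gen_euler (f : nat) (chi : Z -> C) (E : nat -> R -> C)
  : Prop :=
  forall (x : R) (t : C),
    Cmod t < PI / INR f ->
    is_pseries (K := C_AbsRing) (V := C_NormedModule)
      (fun n => Cdiv (E n x) (RtoC (INR (fact n)))) t
      (sum_n (fun m : nat =>
         Cdiv (Cmult (Cmult (RtoC (2 * (-1) ^ m)) (Cconj (chi (Z.of_nat m))))
                     (Cexp (Cmult (RtoC (INR m + x)) t)))
              (Cplus (Cexp (Cmult (RtoC (INR f)) t)) (RtoC 1)))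
         (f - 1)).

(** The theta-type series and the L-series *)

Definition G (eps : nat) (chi : Z -> C) (theta b : R) (r : nat) : C :=
  Cmult (RtoC (INR r))
    (CSeries (fun n : nat =>
       Cmult (Cmult (RtoC ((-1) ^ (eps * n))) (chi (Z.of_nat n)))
             (RtoC (exp (- (INR n + b / INR r) ^ r * theta))))).

Definition Lseries (r eps : nat) (s : C) (b : R) (chi : Z -> C) : C :=
  Cmult (RtoC (INR r))
    (CSeries (fun m : nat =>
       Cdiv (Cmult (RtoC ((-1) ^ (eps * m))) (chi (Z.of_nat m)))
            (Cpow_pos (INR m + b / INR r) s))).

Definition is_L_continuation (r eps : nat) (b : R) (chi : Z -> C) (L : C -> C)
  : Prop :=
  entire L /\ forall s : C, 1 < Re s -> L s = Lseries r eps s b chi.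

(* Main.v *)
Require Import Defs.
From Stdlib Require Import Reals ZArith Arith Lra Lia List Permutation.
From Stdlib Require Import Classical FunctionalExtensionality.
From Coquelicot Require Import Coquelicot.

(* The coefficients [c n = (-1)^(eps n) chi n] are periodic with mean zero, hence
   so are their iterated antiderivatives (normalised to have mean zero).  Summing
   by parts [N] times turns [sum_n c n * h n] into finitely many boundary terms
   plus a sum against the [N]-th difference of [h], bounded by the [N]-th
   derivative of [h].  With [x = b / r]:
   - for [h n = (n + x)^(-s)] this converges when [Re s + N] is large and gives the
     entire continuation (its Taylor series comes from expanding in [s] under the
     sum); at [s = -m] the remainder vanishes as soon as [N > m];
   - for [h n = exp (- (n + x)^r t)] with [N = r (A + 1) + 2] the remainder is
     [O(t^(A+1))], and Taylor expansion of the boundary terms in [t] produces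
     exactly the regularised sums of [(n + x)^(r i)], that is, [L(-r i)].
   For [r = 1] the theta series is a geometric series with a closed form, namely
   the Bernoulli or Euler generating function at [-t], so uniqueness of asymptotic
   expansions identifies the special values.  Any other entire continuation agrees
   at real points by the identity theorem along the real axis. *)

(** Expanding [exp (- (n + x)^r t)] in powers of [t] under the sum gives divergent series of powers
    of [n + x], and the termwise expansions are not uniform in [n]. After [N] summations by parts
    only the finitely many values of [h] in the boundary terms are expanded, so uniformity is asked
    only of the differences of order [N]. In these, every factor [t] comes with [y^r] and costs [r]
    derivatives to extract; two more derivatives leave the summable factor [(n + x)^(-2)]. The same
    [N] exceeds every degree [r i] with [i <= A], so the coefficients come out of the boundary terms
    alone. Up to the factor [r], the value at [-r n] depends on [r] and [n] only through [m = r n]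
    and [x = b / r]. Hence the theta series with exponent one, whose expansion runs through all [m],
    gives the special values for every [r]. *)

Local Open Scope C_scope.

(** * Complex series *)

Fixpoint Csum (a : nat -> C) (n : nat) : C :=
  match n with
  | O => 0
  | S k => Csum a k + a k
  end.

Lemma Csum_ext (a b : nat -> C) (n : nat) :
  (forall k, (k < n)%nat -> a k = b k) -> Csum a n = Csum b n.
Proof.
  induction n as [|n IH]; intros H; simpl; [reflexivity|].
  rewrite IH, H; auto.
Qed.

Lemma Csum_plus (a b : nat -> C) (n : nat) :
  Csum (fun k => a k + b k) n = Csum a n + Csum b n.
Proof. induction n as [|n IH]; simpl; [|rewrite IH]; ring. Qed.

Lemma Csum_minus (a b : nat -> C) (n : nat) :
  Csum (fun k => a k - b k) n = Csum a n - Csum b n.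
Proof. induction n as [|n IH]; simpl; [|rewrite IH]; ring. Qed.

Lemma Csum_scal (z : C) (a : nat -> C) (n : nat) :
  Csum (fun k => z * a k) n = z * Csum a n.
Proof. induction n as [|n IH]; simpl; [|rewrite IH]; ring. Qed.

Lemma Csum_zero (a : nat -> C) (n : nat) :
  (forall k, (k < n)%nat -> a k = 0) -> Csum a n = 0.
Proof.
  induction n as [|n IH]; intros H; simpl; [reflexivity|].
  rewrite IH, H; auto; ring.
Qed.

Lemma Csum_add (a : nat -> C) (m n : nat) :
  Csum a (m + n) = Csum a m + Csum (fun k => a (m + k)%nat) n.
Proof.
  induction n as [|n IH]; simpl.
  - rewrite Nat.add_0_r; ring.
  - rewrite Nat.add_succ_r; simpl; rewrite IH; ring.
Qed.

Lemma sum_n_Csum (a : nat -> C) (n : nat) :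
  sum_n (G := C_AbelianMonoid) a n = Csum a (S n).
Proof.
  induction n as [|n IH].
  - rewrite sum_O; simpl; ring.
  - rewrite sum_Sn, IH; reflexivity.
Qed.

(** Convergence is stated as a real null sequence, so that squeezing and limit arithmetic over the
    reals apply directly. It also certifies a value: [CSeries] is total and says nothing by itself
    when the component series diverge. *)
Definition Csums (a : nat -> C) (l : C) : Prop :=
  is_lim_seq (fun n => Cmod (Csum a n - l)) 0%R.

Lemma is_lim_seq_0_bound (u v : nat -> R) :
  (forall n, 0 <= u n <= v n)%R -> is_lim_seq v 0%R -> is_lim_seq u 0%R.
Proof.
  intros H Hv.
  apply (is_lim_seq_le_le (fun _ => 0%R) u v); auto using is_lim_seq_const.
Qed.

Lemma is_series_Csums (a : nat -> C) (l : C) :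
  is_series (K := C_AbsRing) (V := C_NormedModule) a l <-> Csums a l.
Proof.
  unfold Csums; rewrite is_lim_seq_incr_1; split; intros H.
  - apply is_lim_seq_spec; intros eps.
    assert (L : locally (T := C_NormedModule) l (fun z => Cmod (z - l) < eps)).
    { apply (locally_le_locally_norm (V := C_NormedModule)).
      exists eps; intros y Hy; exact Hy. }
    specialize (H _ L); destruct H as [N HN]; exists N; intros n Hn.
    rewrite Rminus_0_r, Rabs_pos_eq by apply Cmod_ge_0.
    rewrite <- sum_n_Csum; exact (HN n Hn).
  - intros P HP.
    apply (locally_norm_le_locally (V := C_NormedModule)) in HP.
    destruct HP as [eps He]; apply is_lim_seq_spec in H.
    destruct (H eps) as [N HN]; exists N; intros n Hn; apply He.
    specialize (HN n Hn).
    rewrite Rminus_0_r, Rabs_pos_eq in HN by apply Cmod_ge_0.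
    rewrite <- sum_n_Csum in HN; exact HN.
Qed.

Lemma Cmod_minus_sym (a b : C) : Cmod (a - b) = Cmod (b - a).
Proof. rewrite <- Cmod_opp; f_equal; ring. Qed.

Lemma Cmod_minus_triangle (a b c : C) :
  (Cmod (a - c) <= Cmod (a - b) + Cmod (b - c))%R.
Proof. replace (a - c) with ((a - b) + (b - c)) by ring; apply Cmod_triangle. Qed.

Lemma Csums_unique (a : nat -> C) (l1 l2 : C) :
  Csums a l1 -> Csums a l2 -> l1 = l2.
Proof.
  intros H1 H2.
  assert (H : is_lim_seq (fun _ : nat => Cmod (l1 - l2)) 0%R).
  { apply is_lim_seq_0_bound with
      (fun n => Cmod (Csum a n - l1) + Cmod (Csum a n - l2))%R.
    - intros n; split; [apply Cmod_ge_0|].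
      rewrite (Cmod_minus_sym _ l1); apply Cmod_minus_triangle.
    - replace 0%R with (0 + 0)%R by ring; apply is_lim_seq_plus'; assumption. }
  apply is_lim_seq_unique in H; rewrite Lim_seq_const in H.
  injection H as H; apply Cmod_eq_0 in H.
  replace l1 with ((l1 - l2) + l2) by ring; rewrite H; ring.
Qed.

Lemma Csums_ext (a b : nat -> C) (l : C) :
  (forall n, a n = b n) -> Csums a l -> Csums b l.
Proof.
  intros E; unfold Csums; apply is_lim_seq_ext; intros n.
  rewrite (Csum_ext a b); auto.
Qed.

Lemma Csums_scal (z : C) (a : nat -> C) (l : C) :
  Csums a l -> Csums (fun n => z * a n) (z * l).
Proof.
  intros H; unfold Csums.
  apply is_lim_seq_ext with (fun n => Cmod z * Cmod (Csum a n - l))%R.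
  - intros n; rewrite Csum_scal, <- Cmod_mult; f_equal; ring.
  - replace 0%R with (Cmod z * 0)%R by ring.
    apply (is_lim_seq_scal_l _ (Cmod z) 0%R H).
Qed.

Lemma Csums_plus (a b : nat -> C) (l m : C) :
  Csums a l -> Csums b m -> Csums (fun n => a n + b n) (l + m).
Proof.
  intros Ha Hb; unfold Csums.
  apply is_lim_seq_0_bound with
    (fun n => Cmod (Csum a n - l) + Cmod (Csum b n - m))%R.
  - intros n; split; [apply Cmod_ge_0|].
    rewrite Csum_plus.
    replace (Csum a n + Csum b n - (l + m))
      with ((Csum a n - l) + (Csum b n - m)) by ring.
    apply Cmod_triangle.
  - replace 0%R with (0 + 0)%R by ring; apply is_lim_seq_plus'; assumption.
Qed.

Lemma Re_Csum (a : nat -> C) (n : nat) :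
  Re (Csum a (S n)) = sum_n (fun k => Re (a k)) n.
Proof.
  induction n as [|n IH].
  - rewrite sum_O; simpl Csum; rewrite Cplus_0_l; reflexivity.
  - rewrite sum_Sn, <- IH; reflexivity.
Qed.

Lemma Im_Csum (a : nat -> C) (n : nat) :
  Im (Csum a (S n)) = sum_n (fun k => Im (a k)) n.
Proof.
  induction n as [|n IH].
  - rewrite sum_O; simpl Csum; rewrite Cplus_0_l; reflexivity.
  - rewrite sum_Sn, <- IH; reflexivity.
Qed.

Lemma Rabs_Re_le_Cmod (z : C) : (Rabs (Re z) <= Cmod z)%R.
Proof. eapply Rle_trans; [apply Rmax_l|apply Rmax_Cmod]. Qed.

Lemma Rabs_Im_le_Cmod (z : C) : (Rabs (Im z) <= Cmod z)%R.
Proof. eapply Rle_trans; [apply Rmax_r|apply Rmax_Cmod]. Qed.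

Lemma Cmod_le_Re_Im (z : C) : (Cmod z <= Rabs (Re z) + Rabs (Im z))%R.
Proof.
  replace z with (RtoC (Re z) + Ci * RtoC (Im z)) at 1.
  - eapply Rle_trans; [apply Cmod_triangle|].
    rewrite Cmod_mult, !Cmod_R.
    replace (Cmod Ci) with 1%R; [lra|].
    unfold Cmod; simpl; symmetry; replace (_ + _)%R with 1%R by ring; apply sqrt_1.
  - destruct z as [u v]; apply injective_projections; simpl; ring.
Qed.

Lemma is_lim_seq_of_dist (u : nat -> R) (l : R) :
  is_lim_seq (fun n => Rabs (u n - l)) 0%R -> is_lim_seq u l.
Proof.
  intros H.
  apply is_lim_seq_ext with (fun n => (u n - l) + l)%R; [intros; ring|].
  replace (Finite l) with (Finite (0 + l)) by (f_equal; ring).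
  apply is_lim_seq_plus'; [|apply is_lim_seq_const].
  apply is_lim_seq_abs_0, H.
Qed.

Lemma CSeries_unique (a : nat -> C) (l : C) : Csums a l -> CSeries a = l.
Proof.
  intros H; unfold Csums in H; apply is_lim_seq_incr_1 in H.
  unfold CSeries; destruct l as [u v]; f_equal; apply is_series_unique;
    [change (is_lim_seq (sum_n (fun n => Re (a n))) u)
    |change (is_lim_seq (sum_n (fun n => Im (a n))) v)];
    apply is_lim_seq_of_dist;
    refine (is_lim_seq_0_bound _ _ (fun n => conj (Rabs_pos _) _) H).
  - rewrite <- Re_Csum.
    replace (_ - u)%R with (Re (Csum a (S n) - (u, v))) by reflexivity.
    apply Rabs_Re_le_Cmod.
  - rewrite <- Im_Csum.
    replace (_ - v)%R with (Im (Csum a (S n) - (u, v))) by reflexivity.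
    apply Rabs_Im_le_Cmod.
Qed.

Lemma Cmod_Csum_le (a : nat -> C) (B : nat -> R) (n : nat) :
  (forall k, Cmod (a k) <= B k)%R ->
  (Cmod (Csum a (S n)) <= sum_n B n)%R.
Proof.
  intros H; induction n as [|n IH].
  - rewrite sum_O; simpl; rewrite Cplus_0_l; apply H.
  - rewrite sum_Sn; change (Csum a (S (S n))) with (Csum a (S n) + a (S n)).
    eapply Rle_trans; [apply Cmod_triangle|].
    apply Rplus_le_compat; auto.
Qed.

Lemma CSeries_dominated (a : nat -> C) (B : nat -> R) :
  (forall n, Cmod (a n) <= B n)%R -> ex_series B ->
  Csums a (CSeries a) /\ (Cmod (CSeries a) <= Series B)%R.
Proof.
  intros H HB.
  assert (S1 : Csums a (CSeries a)).
  { destruct (ex_series_le (K := C_AbsRing) (V := C_CompleteNormedModule) a B H HB)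
      as [l Hl].
    apply is_series_Csums in Hl.
    rewrite (CSeries_unique a l Hl); exact Hl. }
  split; [exact S1|].
  unfold Csums in S1; rewrite is_lim_seq_incr_1 in S1.
  apply is_lim_seq_le with
    (u := fun _ => Cmod (CSeries a))
    (v := fun n => (sum_n B n + Cmod (Csum a (S n) - CSeries a))%R)
    (l1 := Finite (Cmod (CSeries a))) (l2 := Finite (Series B)).
  - intros n.
    replace (CSeries a) with (Csum a (S n) + - (Csum a (S n) - CSeries a)) at 1 by ring.
    eapply Rle_trans; [apply Cmod_triangle|].
    rewrite Cmod_opp; apply Rplus_le_compat_r, Cmod_Csum_le, H.
  - apply is_lim_seq_const.
  - replace (Finite (Series B)) with (Finite (Series B + 0)) by (f_equal; ring).
    apply is_lim_seq_plus'; [|exact S1].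
    exact (Series_correct B HB).
Qed.

Lemma Cmod_Csum_lim (u : nat -> nat -> C) (v : nat -> C) (n : nat) :
  (forall k, is_lim_seq (fun K => Cmod (u K k - v k)) 0%R) ->
  is_lim_seq (fun K => Cmod (Csum (u K) n - Csum v n)) 0%R.
Proof.
  intros H; induction n as [|n IH]; simpl.
  - apply is_lim_seq_ext with (fun _ => 0%R); [|apply is_lim_seq_const].
    intros _; replace (0 - 0) with (RtoC 0) by ring; symmetry; apply Cmod_0.
  - apply is_lim_seq_0_bound with
      (fun K => Cmod (Csum (u K) n - Csum v n) + Cmod (u K n - v n))%R.
    + intros K; split; [apply Cmod_ge_0|].
      replace (Csum (u K) n + u K n - (Csum v n + v n))
        with ((Csum (u K) n - Csum v n) + (u K n - v n)) by ring.
      apply Cmod_triangle.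
    + replace 0%R with (0 + 0)%R by ring; apply is_lim_seq_plus'; auto.
Qed.

Lemma Csums_shift (a : nat -> C) (l : C) (m : nat) :
  Csums a l -> Csums (fun k => a (m + k)%nat) (l - Csum a m).
Proof.
  intros H; unfold Csums in H; apply (is_lim_seq_incr_n _ m) in H.
  eapply is_lim_seq_ext; [|exact H]; intros k; cbv beta.
  rewrite Nat.add_comm, Csum_add; f_equal; ring.
Qed.

Lemma CSeries_tail_le (a : nat -> C) (B : nat -> R) (n : nat) :
  (forall n, Cmod (a n) <= B n)%R -> ex_series B ->
  (Cmod (CSeries a - Csum a (S n)) <= Series B - sum_n B n)%R.
Proof.
  intros H HB.
  assert (HB' : ex_series (fun k => B (S n + k)%nat)).
  { apply (ex_series_incr_n B (S n)); exact HB. }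
  destruct (CSeries_dominated a B H HB) as [S1 _].
  destruct (CSeries_dominated (fun k => a (S n + k)%nat) _ (fun k => H _) HB')
    as [S2 Hle].
  pose proof (Csums_shift a _ (S n) S1) as S3.
  rewrite <- (Csums_unique _ _ _ S2 S3).
  eapply Rle_trans; [exact Hle|].
  rewrite (Series_incr_n B (S n)) by (first [assumption | lia]).
  rewrite <- sum_n_Reals; simpl; lra.
Qed.

(** Dominated convergence for series. Past a rank [n] both tails are at most the tail of [B], and
    the finite head converges termwise; each of the three errors is made less than [eps / 3]. *)
Lemma CSeries_dominated_lim (u : nat -> nat -> C) (v : nat -> C) (B : nat -> R) :
  (forall K n, Cmod (u K n) <= B n)%R -> ex_series B ->
  (forall n, is_lim_seq (fun K => Cmod (u K n - v n)) 0%R) ->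
  (forall n, Cmod (v n) <= B n)%R /\
  is_lim_seq (fun K => Cmod (CSeries (u K) - CSeries v)) 0%R.
Proof.
  intros HB exB Hlim.
  assert (Hv : forall n, (Cmod (v n) <= B n)%R).
  { intros n.
    apply is_lim_seq_le with
      (u := fun _ => Cmod (v n)) (v := fun K => (B n + Cmod (u K n - v n))%R)
      (l1 := Finite (Cmod (v n))) (l2 := Finite (B n)).
    - intros K.
      replace (v n) with (u K n + - (u K n - v n)) at 1 by ring.
      eapply Rle_trans; [apply Cmod_triangle|].
      rewrite Cmod_opp; apply Rplus_le_compat_r, HB.
    - apply is_lim_seq_const.
    - replace (Finite (B n)) with (Finite (B n + 0)) by (f_equal; ring).
      apply is_lim_seq_plus'; [apply is_lim_seq_const|apply Hlim]. }
  split; [exact Hv|].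
  apply is_lim_seq_spec; intros eps.
  assert (HS := Series_correct B exB).
  change (is_lim_seq (sum_n B) (Series B)) in HS.
  apply is_lim_seq_spec in HS.
  assert (e3 : (0 < eps / 3)%R) by (destruct eps; simpl; lra).
  destruct (HS (mkposreal _ e3)) as [n Hn]; specialize (Hn n (Nat.le_refl n)).
  simpl pos in Hn; apply Rabs_def2 in Hn.
  assert (Hf := Cmod_Csum_lim u v (S n) Hlim).
  apply is_lim_seq_spec in Hf.
  destruct (Hf (mkposreal _ e3)) as [K0 HK]; exists K0; intros K HK0.
  specialize (HK K HK0); simpl pos in HK.
  rewrite Rminus_0_r, Rabs_pos_eq in HK |- * by apply Cmod_ge_0.
  assert (T1 := CSeries_tail_le (u K) B n (HB K) exB).
  assert (T2 := CSeries_tail_le v B n Hv exB).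
  assert (T3 := Cmod_minus_triangle (CSeries (u K)) (Csum (u K) (S n)) (CSeries v)).
  assert (T4 := Cmod_minus_triangle (Csum (u K) (S n)) (Csum v (S n)) (CSeries v)).
  rewrite (Cmod_minus_sym (Csum v (S n)) (CSeries v)) in T4.
  lra.
Qed.

(** * Regularised sums against a zero-mean periodic sequence *)

Lemma Csum_const (z : C) (n : nat) : Csum (fun _ => z) n = RtoC (INR n) * z.
Proof.
  induction n as [|n IH]; [simpl; ring|].
  rewrite S_INR, RtoC_plus; simpl Csum; rewrite IH; ring.
Qed.

Definition nabla (h : nat -> C) : nat -> C := fun n => h n - h (S n).

(** The inner difference is taken first, so that [nablan (S N) h] is convertible to
    [nablan N (nabla h)] and inductions over summation by parts peel off one [nabla] by computation.
    The sign of [nabla] is the one that Abel summation produces. *)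
Fixpoint nablan (N : nat) (h : nat -> C) : nat -> C :=
  match N with
  | O => h
  | S k => nablan k (nabla h)
  end.

Lemma nablan_ext (N : nat) (g h : nat -> C) :
  (forall n, g n = h n) -> forall n, nablan N g n = nablan N h n.
Proof.
  revert g h; induction N as [|N IH]; intros g h E; [exact E|].
  apply IH; intros n; unfold nabla; rewrite !E; reflexivity.
Qed.

Lemma nablan_S (N : nat) (h : nat -> C) (n : nat) :
  nablan (S N) h n = nablan N h n - nablan N h (S n).
Proof.
  revert h; induction N as [|N IH]; intros h; [reflexivity|].
  change (nablan (S N) (nabla h) n = nablan N (nabla h) n - nablan N (nabla h) (S n)).
  apply IH.
Qed.

Lemma nablan_minus (N : nat) (g h : nat -> C) (n : nat) :
  nablan N (fun n => g n - h n) n = nablan N g n - nablan N h n.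
Proof.
  revert n; induction N as [|N IH]; intros n; [reflexivity|].
  rewrite !nablan_S, !IH; ring.
Qed.

Lemma nablan_scal (N : nat) (z : C) (h : nat -> C) (n : nat) :
  nablan N (fun n => z * h n) n = z * nablan N h n.
Proof.
  revert n; induction N as [|N IH]; intros n; [reflexivity|].
  rewrite !nablan_S, !IH; ring.
Qed.

Definition mean_partial (p : nat) (c : nat -> C) : C :=
  Csum (fun n => Csum c (S n)) p / RtoC (INR p).

Definition anti (p : nat) (c : nat -> C) : nat -> C :=
  fun n => Csum c (S n) - mean_partial p c.

Definition zero_mean (p : nat) (c : nat -> C) : Prop :=
  (0 < p)%nat /\ (forall n, c (n + p)%nat = c n) /\ Csum c p = 0.

(** The zero sum of [c] over a period makes its partial sums periodic; subtracting their mean then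
    restores the zero sum, so the construction can be iterated. *)
Lemma anti_zero_mean (p : nat) (c : nat -> C) :
  zero_mean p c -> zero_mean p (anti p c).
Proof.
  intros (Hp & Hper & Hsum); split; [exact Hp|split].
  - intros n; unfold anti; f_equal.
    replace (S (n + p)) with (p + S n)%nat by lia.
    rewrite Csum_add, Hsum, Cplus_0_l; apply Csum_ext; intros k _.
    rewrite Nat.add_comm; apply Hper.
  - unfold anti; rewrite Csum_minus, Csum_const; unfold mean_partial.
    field; intros E; apply RtoC_inj in E; apply not_0_INR in E; lia.
Qed.

Lemma zero_mean_bounded (p : nat) (c : nat -> C) :
  zero_mean p c -> exists M, (0 <= M)%R /\ forall n, (Cmod (c n) <= M)%R.
Proof.
  intros (Hp & Hper & _).
  assert (Hfin : forall q, exists M, (0 <= M)%R /\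
            forall n, (n < q)%nat -> (Cmod (c n) <= M)%R).
  { induction q as [|q (M & HM & IH)].
    - exists 0%R; split; [lra|]; intros n Hn; lia.
    - exists (M + Cmod (c q))%R; pose proof (Cmod_ge_0 (c q)).
      split; [lra|]; intros n Hn.
      destruct (Nat.eq_dec n q) as [->|Hne]; [lra|].
      specialize (IH n ltac:(lia)); lra. }
  destruct (Hfin p) as (M & HM & H); exists M; split; [exact HM|].
  intros n; induction n as [n IH] using lt_wf_ind.
  destruct (lt_dec n p) as [Hlt|Hge]; [auto|].
  replace n with ((n - p) + p)%nat by lia; rewrite Hper; apply IH; lia.
Qed.

Definition vanishes (h : nat -> C) : Prop := is_lim_seq (fun n => Cmod (h n)) 0%R.

Lemma vanishes_nabla (h : nat -> C) : vanishes h -> vanishes (nabla h).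
Proof.
  intros H; unfold vanishes, nabla.
  apply is_lim_seq_0_bound with (fun n => Cmod (h n) + Cmod (h (S n)))%R.
  - intros n; split; [apply Cmod_ge_0|].
    rewrite <- (Cmod_opp (h (S n))); apply Cmod_triangle.
  - replace 0%R with (0 + 0)%R by ring; apply is_lim_seq_plus'; [exact H|].
    apply is_lim_seq_incr_1 in H; exact H.
Qed.

(** Abel summation with the antiderivative [Csum c k - mean_partial p c]: its value at [0] is
    [- mean_partial p c], hence the sign of the first boundary term, and its value at [S k] is
    [anti p c k]. *)
Lemma Csum_by_parts (p : nat) (c h : nat -> C) (n : nat) :
  Csum (fun k => c k * h k) n =
  mean_partial p c * h O + Csum (fun k => anti p c k * nabla h k) n
  + (Csum c n - mean_partial p c) * h n.
Proof.
  induction n as [|n IH]; simpl; [ring|].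
  rewrite IH; unfold anti, nabla; simpl; ring.
Qed.

Lemma boundary_vanishes (p : nat) (c h : nat -> C) :
  zero_mean p c -> vanishes h ->
  is_lim_seq (fun n => Cmod ((Csum c n - mean_partial p c) * h n)) 0%R.
Proof.
  intros Hc Hh.
  destruct (zero_mean_bounded p (anti p c) (anti_zero_mean p c Hc)) as (M & HM & HB).
  apply is_lim_seq_incr_1, is_lim_seq_0_bound with (fun n => M * Cmod (h (S n)))%R.
  - intros n; split; [apply Cmod_ge_0|].
    rewrite Cmod_mult; apply Rmult_le_compat_r; [apply Cmod_ge_0|apply HB].
  - replace 0%R with (M * 0)%R by ring.
    apply (is_lim_seq_scal_l _ M 0%R); apply is_lim_seq_incr_1 in Hh; exact Hh.
Qed.

Lemma Csums_by_parts (p : nat) (c h : nat -> C) (l : C) :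
  zero_mean p c -> vanishes h ->
  Csums (fun k => anti p c k * nabla h k) l ->
  Csums (fun k => c k * h k) (mean_partial p c * h O + l).
Proof.
  intros Hc Hh Hl; unfold Csums.
  eapply is_lim_seq_0_bound.
  - intros n; split; [apply Cmod_ge_0|].
    rewrite (Csum_by_parts p c h n).
    match goal with |- (Cmod (?m + ?s + ?t - _) <= _)%R =>
      replace (m + s + t - (m + l)) with ((s - l) + t) by ring end.
    apply Cmod_triangle.
  - replace 0%R with (0 + 0)%R by ring; apply is_lim_seq_plus'; [exact Hl|].
    exact (boundary_vanishes p c h Hc Hh).
Qed.

(* The sum [sum_n c n * h n] after [N] summations by parts; it makes sense, and
   stops depending on [N], as soon as [nablan N h] is summable. *)
Fixpoint regsum (p N : nat) (c h : nat -> C) : C :=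
  match N with
  | O => CSeries (fun n => c n * h n)
  | S k => mean_partial p c * h O + regsum p k (anti p c) (nabla h)
  end.

(** The summable majorant is fixed up to the constant [M], so uniformity in a parameter, such as [t]
    or a truncation index, reduces to a uniform choice of [M]. *)
Definition decays (x : R) (N : nat) (h : nat -> C) : Prop :=
  exists M, forall n, (Cmod (nablan N h n) <= M / (INR n + x) ^ 2)%R.

Lemma INR_shift_pos (x : R) (n : nat) : (0 < x -> 0 < INR n + x)%R.
Proof. intros Hx; pose proof (pos_INR n); lra. Qed.

Lemma ex_series_inv_sqr (x M : R) :
  (0 < x)%R -> ex_series (fun n => M / (INR n + x) ^ 2)%R.
Proof.
  intros Hx.
  apply (ex_series_ext (fun n => M * / (INR n + x) ^ 2)%R); [reflexivity|].
  apply (ex_series_scal_l M (fun n => / (INR n + x) ^ 2)%R).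
  (* With [y = n + x], this compares with a telescoping series: the ratio of [/ y ^ 2] to
     [/ y - / (y + 1)] is [1 + / y], at most [1 + / x]. *)
  apply (ex_series_le (K := R_AbsRing) (V := R_CompleteNormedModule) _
           (fun n => (1 + / x) * (/ (INR n + x) - / (INR (S n) + x)))%R).
  - intros n; change (norm ?y) with (Rabs y).
    pose proof (INR_shift_pos x n Hx) as Hn.
    rewrite S_INR, Rabs_pos_eq by (left; apply Rinv_0_lt_compat; nra).
    replace ((1 + / x) * (/ (INR n + x) - / (INR n + 1 + x)))%R
      with (/ (INR n + x) ^ 2 * ((1 + / x) * ((INR n + x) / (INR n + 1 + x))))%R
      by (field; lra).
    rewrite <- (Rmult_1_r (/ (INR n + x) ^ 2)) at 1.
    apply Rmult_le_compat_l; [left; apply Rinv_0_lt_compat; nra|].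
    apply Rmult_le_reg_r with (x * (INR n + 1 + x))%R; [nra|].
    replace ((1 + / x) * ((INR n + x) / (INR n + 1 + x)) * (x * (INR n + 1 + x)))%R
      with ((x + 1) * (INR n + x))%R by (field; lra).
    pose proof (pos_INR n); nra.
  - apply (ex_series_scal_l (1 + / x)%R (fun n => / (INR n + x) - / (INR (S n) + x))%R).
    exists (/ x)%R.
    change (is_lim_seq (sum_n (fun n => / (INR n + x) - / (INR (S n) + x))%R) (/ x)%R).
    apply is_lim_seq_ext with (fun n => / x - / (INR (S n) + x))%R.
    + induction n as [|n IH].
      * rewrite sum_O; simpl; rewrite Rplus_0_l; reflexivity.
      * rewrite sum_Sn, <- IH; change (plus ?a ?b) with (a + b)%R; ring.
    + replace (Finite (/ x)) with (Finite (/ x - 0)) by (f_equal; ring).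
      apply is_lim_seq_minus'; [apply is_lim_seq_const|].
      apply is_lim_seq_incr_1 with (u := fun n => (/ (INR n + x))%R).
      apply (is_lim_seq_inv _ p_infty); [|discriminate].
      apply is_lim_seq_plus with p_infty x;
        [apply is_lim_seq_INR|apply is_lim_seq_const|reflexivity].
Qed.

Lemma inv_sqr_le (a b : R) : (0 < a <= b -> / b ^ 2 <= / a ^ 2)%R.
Proof. intros H; apply Rinv_le_contravar; nra. Qed.

Lemma bound_nonneg (x M : R) (z : C) (n : nat) :
  (0 < x)%R -> (Cmod z <= M / (INR n + x) ^ 2)%R -> (0 <= M)%R.
Proof.
  intros Hx H; pose proof (INR_shift_pos x n Hx); pose proof (Cmod_ge_0 z).
  apply Rmult_le_reg_r with (/ (INR n + x) ^ 2)%R.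
  - apply Rinv_0_lt_compat; nra.
  - rewrite Rmult_0_l; unfold Rdiv in H; lra.
Qed.

Lemma decays_S (x : R) (N : nat) (h : nat -> C) :
  (0 < x)%R -> decays x N h -> decays x (S N) h.
Proof.
  intros Hx (M & HM); exists (M + M)%R; intros n; rewrite nablan_S.
  pose proof (INR_shift_pos x n Hx).
  pose proof (bound_nonneg x M _ n Hx (HM n)).
  replace ((M + M) / (INR n + x) ^ 2)%R
    with (M / (INR n + x) ^ 2 + M / (INR n + x) ^ 2)%R by (unfold Rdiv; ring).
  eapply Rle_trans; [apply Cmod_triangle|]; rewrite Cmod_opp.
  apply Rplus_le_compat; [apply HM|].
  eapply Rle_trans; [apply HM|].
  apply Rmult_le_compat_l; [assumption|]; apply inv_sqr_le.
  rewrite S_INR; lra.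
Qed.

Lemma decays_le (x : R) (N M : nat) (h : nat -> C) :
  (0 < x)%R -> (N <= M)%nat -> decays x N h -> decays x M h.
Proof. intros Hx Hle H; induction Hle; auto using decays_S. Qed.

Lemma decays_0_vanishes (x : R) (h : nat -> C) :
  (0 < x)%R -> decays x 0 h -> vanishes h.
Proof.
  intros Hx (M & HM).
  apply is_lim_seq_0_bound with (fun n => M / (INR n + x) ^ 2)%R.
  - intros n; split; [apply Cmod_ge_0|apply HM].
  - apply ex_series_lim_0, ex_series_inv_sqr, Hx.
Qed.

Lemma Cmod_mult_decays (x M Mc : R) (c h : nat -> C) :
  (0 < x)%R -> (0 <= Mc)%R -> (forall n, Cmod (c n) <= Mc)%R ->
  (forall n, Cmod (h n) <= M / (INR n + x) ^ 2)%R ->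
  (forall n, Cmod (c n * h n) <= (Mc * M) / (INR n + x) ^ 2)%R.
Proof.
  intros Hx HMc Hc Hh n; rewrite Cmod_mult.
  replace (Mc * M / (INR n + x) ^ 2)%R with (Mc * (M / (INR n + x) ^ 2))%R
    by (unfold Rdiv; ring).
  apply Rmult_le_compat; auto using Cmod_ge_0.
Qed.

Lemma Csums_decays_0 (p : nat) (x : R) (c h : nat -> C) :
  (0 < x)%R -> zero_mean p c -> decays x 0 h ->
  Csums (fun n => c n * h n) (CSeries (fun n => c n * h n)).
Proof.
  intros Hx Hc (M & HM).
  destruct (zero_mean_bounded p c Hc) as (Mc & H0 & HMc).
  apply CSeries_dominated with (fun n => Mc * M / (INR n + x) ^ 2)%R.
  - apply Cmod_mult_decays; auto.
  - apply ex_series_inv_sqr, Hx.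
Qed.

(** The link between [regsum] and actual convergence: when [h] vanishes at infinity, so do the
    boundary terms there. For growing [h], such as monomials, [regsum] discards those terms, and
    this defines the regularised value. *)
Lemma Csums_regsum (p N : nat) (x : R) (c h : nat -> C) :
  (0 < x)%R -> zero_mean p c -> vanishes h -> decays x N h ->
  Csums (fun n => c n * h n) (regsum p N c h).
Proof.
  intros Hx; revert c h; induction N as [|N IH]; intros c h Hc Hh Hd.
  - exact (Csums_decays_0 p x c h Hx Hc Hd).
  - apply Csums_by_parts; auto.
    apply IH; auto using anti_zero_mean, vanishes_nabla.
Qed.

(** The first [N] boundary terms agree on both sides, and peeling them off leaves a sequence that
    decays by itself. There one more summation by parts rewrites a convergent series, so both sides
    are its sum. *)
Lemma regsum_S (p N : nat) (x : R) (c h : nat -> C) :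
  (0 < x)%R -> zero_mean p c -> decays x N h ->
  regsum p (S N) c h = regsum p N c h.
Proof.
  intros Hx; revert c h; induction N as [|N IH]; intros c h Hc Hd.
  - apply (Csums_unique (fun n => c n * h n)).
    + apply Csums_regsum with x; eauto using decays_0_vanishes, decays_S.
    + apply Csums_decays_0 with p x; auto.
  - change (mean_partial p c * h O + regsum p (S N) (anti p c) (nabla h) =
            mean_partial p c * h O + regsum p N (anti p c) (nabla h)).
    rewrite IH; auto using anti_zero_mean.
Qed.

Lemma regsum_le (p N M : nat) (x : R) (c h : nat -> C) :
  (0 < x)%R -> zero_mean p c -> (N <= M)%nat -> decays x N h ->
  regsum p M c h = regsum p N c h.
Proof.
  intros Hx Hc Hle Hd; induction Hle as [|M Hle IH]; [reflexivity|].
  rewrite <- IH; apply regsum_S with x; auto.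
  apply decays_le with N; auto.
Qed.

Lemma regsum_ext (p N : nat) (c g h : nat -> C) :
  (forall n, g n = h n) -> regsum p N c g = regsum p N c h.
Proof.
  revert c g h; induction N as [|N IH]; intros c g h E; simpl.
  - unfold CSeries; f_equal; apply Series_ext; intros n; rewrite E; reflexivity.
  - rewrite E; f_equal; apply IH; intros n; unfold nabla; rewrite !E; reflexivity.
Qed.

Lemma decays_scal (x : R) (N : nat) (z : C) (h : nat -> C) :
  decays x N h -> decays x N (fun n => z * h n).
Proof.
  intros (M & HM); exists (Cmod z * M)%R; intros n.
  rewrite nablan_scal, Cmod_mult; unfold Rdiv; rewrite Rmult_assoc.
  apply Rmult_le_compat_l; [apply Cmod_ge_0|apply HM].
Qed.

Lemma regsum_plus (p N : nat) (x : R) (c g h : nat -> C) :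
  (0 < x)%R -> zero_mean p c -> decays x N g -> decays x N h ->
  regsum p N c (fun n => g n + h n) = regsum p N c g + regsum p N c h.
Proof.
  intros Hx; revert c g h; induction N as [|N IH]; intros c g h Hc Hg Hh.
  - apply CSeries_unique.
    apply Csums_ext with (fun n => c n * g n + c n * h n); [intros; ring|].
    apply Csums_plus; apply (Csums_decays_0 p x); auto.
  - simpl.
    rewrite (regsum_ext _ _ _ _ (fun n => nabla g n + nabla h n))
      by (intros n; unfold nabla; ring).
    rewrite IH by auto using anti_zero_mean; ring.
Qed.

Lemma regsum_scal (p N : nat) (x : R) (z : C) (c h : nat -> C) :
  (0 < x)%R -> zero_mean p c -> decays x N h ->
  regsum p N c (fun n => z * h n) = z * regsum p N c h.
Proof.
  intros Hx; revert c h; induction N as [|N IH]; intros c h Hc Hh.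
  - apply CSeries_unique.
    apply Csums_ext with (fun n => z * (c n * h n)); [intros; ring|].
    apply Csums_scal, (Csums_decays_0 p x); auto.
  - simpl.
    rewrite (regsum_ext _ _ _ _ (fun n => z * nabla h n))
      by (intros n; unfold nabla; ring).
    rewrite IH by auto using anti_zero_mean; ring.
Qed.

Lemma regsum_zero (p N : nat) (c : nat -> C) : regsum p N c (fun _ => 0) = 0.
Proof.
  revert c; induction N as [|N IH]; intros c.
  - apply CSeries_unique; unfold Csums.
    apply is_lim_seq_ext with (fun _ => 0%R); [|apply is_lim_seq_const].
    intros n; rewrite Csum_zero by (intros; ring).
    replace (0 - 0) with (RtoC 0) by ring; symmetry; apply Cmod_0.
  - simpl; rewrite (regsum_ext _ _ _ _ (fun _ => 0)), IH
      by (intros; unfold nabla; ring); ring.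
Qed.

Lemma is_lim_seq_nabla (u : nat -> nat -> C) (v : nat -> C) (n : nat) :
  (forall n, is_lim_seq (fun K => Cmod (u K n - v n)) 0%R) ->
  is_lim_seq (fun K => Cmod (nabla (u K) n - nabla v n)) 0%R.
Proof.
  intros H; unfold nabla.
  apply is_lim_seq_0_bound with
    (fun K => Cmod (u K n - v n) + Cmod (u K (S n) - v (S n)))%R.
  - intros K; split; [apply Cmod_ge_0|].
    rewrite <- (Cmod_opp (u K (S n) - _)).
    replace (u K n - u K (S n) - (v n - v (S n)))
      with ((u K n - v n) + - (u K (S n) - v (S n))) by ring.
    apply Cmod_triangle.
  - replace 0%R with (0 + 0)%R by ring; apply is_lim_seq_plus'; auto.
Qed.

(** The boundary terms involve finitely many values of the sequence, so pointwise convergence is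
    enough for them; dominated convergence, with [M] independent of [K], handles the remaining
    series. *)
Lemma regsum_lim (p N : nat) (x M : R) (c : nat -> C) (u : nat -> nat -> C)
    (v : nat -> C) :
  (0 < x)%R -> zero_mean p c ->
  (forall K n, Cmod (nablan N (u K) n) <= M / (INR n + x) ^ 2)%R ->
  (forall n, is_lim_seq (fun K => Cmod (u K n - v n)) 0%R) ->
  decays x N v /\
  is_lim_seq (fun K => Cmod (regsum p N c (u K) - regsum p N c v)) 0%R.
Proof.
  intros Hx; revert c u v; induction N as [|N IH]; intros c u v Hc Hu Hv.
  - destruct (zero_mean_bounded p c Hc) as (Mc & H0 & HMc); split.
    + exists M; apply (CSeries_dominated_lim u v (fun n => M / (INR n + x) ^ 2)%R);
        auto using ex_series_inv_sqr.
    + apply (CSeries_dominated_lim (fun K n => c n * u K n) (fun n => c n * v n)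
               (fun n => Mc * M / (INR n + x) ^ 2)%R).
      * intros K; apply Cmod_mult_decays; auto; apply Hu.
      * apply ex_series_inv_sqr, Hx.
      * intros n.
        apply is_lim_seq_ext with (fun K => Cmod (c n) * Cmod (u K n - v n))%R.
        -- intros K; rewrite <- Cmod_mult; f_equal; ring.
        -- replace 0%R with (Cmod (c n) * 0)%R by ring.
           apply (is_lim_seq_scal_l _ (Cmod (c n)) 0%R), Hv.
  - destruct (IH (anti p c) (fun K => nabla (u K)) (nabla v)) as [Hd Hl];
      auto using anti_zero_mean, is_lim_seq_nabla.
    split; [exact Hd|]; simpl.
    apply is_lim_seq_0_bound with
      (fun K => Cmod (mean_partial p c) * Cmod (u K O - v O)
        + Cmod (regsum p N (anti p c) (nabla (u K)) -
                regsum p N (anti p c) (nabla v)))%R.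
    + intros K; split; [apply Cmod_ge_0|].
      rewrite <- Cmod_mult.
      match goal with |- (Cmod ?a <= Cmod ?b + Cmod ?d)%R =>
        replace a with (b + d) by ring end.
      apply Cmod_triangle.
    + replace 0%R with (Cmod (mean_partial p c) * 0 + 0)%R by ring.
      apply is_lim_seq_plus'; [|exact Hl].
      apply (is_lim_seq_scal_l _ (Cmod (mean_partial p c)) 0%R), Hv.
Qed.

(** * Asymptotic expansions *)

(** One order at a time: the number of summations by parts depends on [A], so the expansion of the
    theta series is proved for each [A] separately. *)
Definition expands (A : nat) (F : R -> C) (g : nat -> C) : Prop :=
  exists M d : R, (0 < d)%R /\ forall t : R, (0 < t < d)%R ->
    (Cmod (F t - Csum (fun i => g i * RtoC (t ^ i)%R)%C (S A)) <= M * t ^ S A)%R.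

Lemma at_right_0_iff (P : R -> Prop) :
  at_right 0 P <-> exists d : R, (0 < d)%R /\ forall t, (0 < t < d)%R -> P t.
Proof.
  split.
  - intros [e He]; exists e; split; [apply cond_pos|]; intros t Ht.
    apply He; [|lra].
    change (Rabs (t - 0) < e)%R; rewrite Rabs_pos_eq; lra.
  - intros (d & Hd & H); exists (mkposreal d Hd); intros t Ht Hpos.
    change (Rabs (t - 0) < d)%R in Ht; apply Rabs_def2 in Ht; apply H; lra.
Qed.

Lemma asymptotic_expansion_expands (F : R -> C) (g : nat -> C) :
  asymptotic_expansion F g <-> forall A, expands A F g.
Proof.
  unfold asymptotic_expansion, expands; split; intros H A;
    destruct (H A) as [M HM]; exists M.
  - apply at_right_0_iff in HM; destruct HM as (d & Hd & HM).
    exists d; split; [exact Hd|]; intros t Ht.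
    rewrite <- sum_n_Csum; exact (HM t Ht).
  - apply at_right_0_iff; destruct HM as (d & Hd & HM).
    exists d; split; [exact Hd|]; intros t Ht.
    specialize (HM t Ht); rewrite <- sum_n_Csum in HM; exact HM.
Qed.

Lemma expands_ext (A : nat) (F G : R -> C) (g h : nat -> C) :
  (exists d : R, (0 < d)%R /\ forall t, (0 < t < d)%R -> F t = G t) ->
  (forall i, (i <= A)%nat -> g i = h i) ->
  expands A F g -> expands A G h.
Proof.
  intros (d & Hd & E) Eg (M & d' & Hd' & H).
  exists M, (Rmin d d'); split; [apply Rmin_glb_lt; assumption|].
  intros t [Ht0 Ht].
  pose proof (Rmin_l d d'); pose proof (Rmin_r d d').
  rewrite <- E, <- (Csum_ext (fun i => g i * RtoC (t ^ i)%R)).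
  - apply H; lra.
  - intros k Hk; rewrite Eg; [reflexivity|lia].
  - lra.
Qed.

Lemma expands_plus (A : nat) (F G : R -> C) (g h : nat -> C) :
  expands A F g -> expands A G h ->
  expands A (fun t => F t + G t) (fun i => g i + h i).
Proof.
  intros (M & d & Hd & H) (M' & d' & Hd' & H').
  exists (M + M')%R, (Rmin d d'); split; [apply Rmin_glb_lt; assumption|].
  intros t [Ht0 Ht].
  pose proof (Rmin_l d d'); pose proof (Rmin_r d d').
  specialize (H t ltac:(lra)); specialize (H' t ltac:(lra)).
  rewrite (Csum_ext _ (fun i => g i * RtoC (t ^ i)%R + h i * RtoC (t ^ i)%R))
    by (intros; ring).
  rewrite Csum_plus, Rmult_plus_distr_r.
  match goal with |- (Cmod (?a + ?b - (?u + ?v)) <= _)%R =>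
    replace (a + b - (u + v)) with ((a - u) + (b - v)) by ring end.
  eapply Rle_trans; [apply Cmod_triangle|]; lra.
Qed.

Lemma expands_scal (A : nat) (z : C) (F : R -> C) (g : nat -> C) :
  expands A F g -> expands A (fun t => z * F t) (fun i => z * g i).
Proof.
  intros (M & d & Hd & H); exists (Cmod z * M)%R, d; split; [exact Hd|].
  intros t Ht.
  rewrite (Csum_ext _ (fun i => z * (g i * RtoC (t ^ i)%R))) by (intros; ring).
  rewrite Csum_scal.
  match goal with |- (Cmod (?a * ?b - ?a * ?v) <= _)%R =>
    replace (a * b - a * v) with (a * (b - v)) by ring end.
  rewrite Cmod_mult, Rmult_assoc.
  apply Rmult_le_compat_l; [apply Cmod_ge_0|auto].
Qed.

Lemma expands_minus (A : nat) (F G : R -> C) (g h : nat -> C) :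
  expands A F g -> expands A G h ->
  expands A (fun t => F t - G t) (fun i => g i - h i).
Proof.
  intros HF HG; apply (expands_scal A (-1)) in HG.
  apply expands_ext with (3 := expands_plus _ _ _ _ _ HF HG).
  - exists 1%R; split; [lra|]; intros; ring.
  - intros; ring.
Qed.

Lemma expands_0_coeff (g : nat -> C) :
  (forall A, expands A (fun _ => 0) g) -> forall n, g n = 0.
Proof.
  intros H n; induction n as [n IH] using lt_wf_ind.
  destruct (H n) as (M & d & Hd & Hn).
  apply Cmod_eq_0, Rle_antisym; [|apply Cmod_ge_0].
  apply Rnot_lt_le; intros Hpos.
  (* A nonzero [g n] would be the leading coefficient. This [t] makes [(Rabs M + 1) * t] at most
     half of [Cmod (g n)], against the bound [Cmod (g n) <= M * t] left after division by
     [t ^ n]. *)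
  pose (t := Rmin (d / 2) (Cmod (g n) / (2 * (Rabs M + 1)))%R).
  pose proof (Rabs_pos M) as HM0; pose proof (Rle_abs M) as HM1.
  assert (Ht2 : (t * (Rabs M + 1) <= Cmod (g n) / 2)%R).
  { replace (Cmod (g n) / 2)%R
      with (Cmod (g n) / (2 * (Rabs M + 1)) * (Rabs M + 1))%R by (field; lra).
    apply Rmult_le_compat_r; [lra|apply Rmin_r]. }
  assert (Ht : (0 < t < d)%R).
  { split; [apply Rmin_glb_lt; [lra|apply Rdiv_lt_0_compat; lra]|].
    apply Rle_lt_trans with (d / 2)%R; [apply Rmin_l|lra]. }
  specialize (Hn t Ht); simpl Csum in Hn.
  rewrite Csum_zero in Hn
    by (intros k Hk; rewrite (IH k Hk); ring).
  replace (0 - (0 + g n * RtoC (t ^ n)%R)) with (- (g n * RtoC (t ^ n)%R)) in Hn by ring.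
  assert (Htn : (0 < t ^ n)%R) by (apply pow_lt; lra).
  rewrite Cmod_opp, Cmod_mult, Cmod_R, Rabs_pos_eq in Hn by lra.
  replace (M * t ^ S n)%R with (M * t * t ^ n)%R in Hn by (simpl; ring).
  apply Rmult_le_reg_r in Hn; [|exact Htn].
  nra.
Qed.

Lemma asymptotic_expansion_unique (F : R -> C) (g h : nat -> C) :
  (forall A, expands A F g) -> (forall A, expands A F h) -> forall n, g n = h n.
Proof.
  intros Hg Hh n.
  assert (E : g n - h n = 0).
  { apply (expands_0_coeff (fun i => g i - h i)); intros A.
    apply expands_ext with (3 := expands_minus _ _ _ _ _ (Hg A) (Hh A)); auto.
    exists 1%R; split; [lra|]; intros; ring. }
  replace (g n) with (g n - h n + h n) by ring; rewrite E; ring.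
Qed.

(** * Convergent power series as asymptotic expansions *)

Lemma Csums_terms_bounded (a : nat -> C) (l : C) :
  Csums a l -> exists M, forall n, (Cmod (a n) <= M)%R.
Proof.
  intros H; unfold Csums in H.
  assert (H2 : ex_finite_lim_seq (fun n => Cmod (Csum a n - l))) by (exists 0%R; exact H).
  destruct (filterlim_bounded (K := R_AbsRing) (V := R_NormedModule) _ H2) as [M HM].
  exists (M + M)%R; intros n.
  pose proof (HM n) as H1; pose proof (HM (S n)) as H3.
  change (norm ?y) with (Rabs y) in *.
  rewrite Rabs_pos_eq in H1, H3 by apply Cmod_ge_0.
  replace (a n) with ((Csum a (S n) - l) + - (Csum a n - l)) by (simpl; ring).
  eapply Rle_trans; [apply Cmod_triangle|]; rewrite Cmod_opp; lra.
Qed.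

Lemma expands_power_series (F : R -> C) (a : nat -> C) (d : R) :
  (0 < d)%R ->
  (forall t, (0 < t < d)%R -> Csums (fun k => a k * RtoC (t ^ k)%R) (F t)) ->
  forall A, expands A F a.
Proof.
  intros Hd H A.
  (* At the interior point [u] the terms are bounded by some [M]. For [t < u / 2] they are at most
     [M * q ^ k] with [q = t / u <= / 2], and the geometric tail is at most [2 * M * q ^ S A]. *)
  pose (u := (d / 2)%R); assert (Hu : (0 < u < d)%R) by (unfold u; lra).
  destruct (Csums_terms_bounded _ _ (H u Hu)) as [M HM].
  exists (2 * M / u ^ S A)%R, (u / 2)%R; split; [lra|]; intros t Ht.
  pose (q := (t / u)%R).
  assert (Hq : (0 < q <= / 2)%R).
  { unfold q; split; [apply Rdiv_lt_0_compat; lra|].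
    apply Rmult_le_reg_r with u; [lra|]; unfold Rdiv.
    rewrite Rmult_assoc, Rinv_l; lra. }
  assert (Hqk : forall k, (0 < q ^ k)%R) by (intros k; apply pow_lt; lra).
  assert (HB : forall k, (Cmod (a k * RtoC (t ^ k)%R) <= M * q ^ k)%R).
  { intros k.
    replace (t ^ k)%R with (u ^ k * q ^ k)%R
      by (rewrite <- Rpow_mult_distr; f_equal; unfold q; field; lra).
    rewrite RtoC_mult, Cmult_assoc, Cmod_mult, (Cmod_R (q ^ k)).
    rewrite (Rabs_pos_eq (q ^ k)) by (left; apply Hqk).
    apply Rmult_le_compat_r; [left; apply Hqk|apply HM]. }
  assert (HS := is_series_geom q ltac:(rewrite Rabs_pos_eq; lra)).
  assert (Hex : ex_series (fun k => M * q ^ k)%R).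
  { apply (ex_series_scal_l M (fun k => q ^ k)%R); eexists; exact HS. }
  rewrite <- (CSeries_unique _ _ (H t ltac:(unfold u in *; lra))).
  eapply Rle_trans; [exact (CSeries_tail_le _ _ A HB Hex)|].
  rewrite (Series_incr_n _ (S A)) by (first [assumption | lia]).
  rewrite sum_n_Reals; simpl pred.
  rewrite (Series_ext _ (fun k => (M * q ^ S A) * q ^ k)%R)
    by (intros k; rewrite pow_add; ring).
  rewrite (Series_scal_l (M * q ^ S A) (fun k => q ^ k)%R), (is_series_unique _ _ HS).
  replace (2 * M / u ^ S A * t ^ S A)%R with (M * q ^ S A * 2)%R.
  2:{ unfold q, Rdiv; rewrite Rpow_mult_distr, pow_inv; ring. }
  ring_simplify (sum_f_R0 (fun k => M * q ^ k) A + M * q ^ S A * / (1 - q)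
                 - sum_f_R0 (fun k => M * q ^ k) A)%R.
  assert (HM0 : (0 <= M)%R).
  { eapply Rle_trans; [apply Cmod_ge_0|apply (HM O)]. }
  rewrite Rmult_assoc, (Rmult_assoc M).
  apply Rmult_le_compat_l; [exact HM0|].
  apply Rmult_le_compat_l; [left; apply Hqk|].
  rewrite <- (Rinv_inv 2); apply Rinv_le_contravar; lra.
Qed.

(** The termwise expansions need not be uniform in [n]: each summation by parts uses them only at
    index [0] of the current difference. At the innermost level the coefficient sequences have
    become zero, so it remains to show that the last series is [O(t ^ S A)], which follows from the
    uniform bound on the differences. *)
Lemma regsum_expands (p N A : nat) (x : R) (c : nat -> C) (h : R -> nat -> C)
    (g : nat -> nat -> C) :
  (0 < x)%R -> zero_mean p c ->
  (forall n, expands A (fun t => h t n) (fun i => g i n)) ->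
  (exists M d, (0 < d)%R /\ forall t n, (0 < t < d)%R ->
     (Cmod (nablan N (h t) n) <= M * t ^ S A / (INR n + x) ^ 2)%R) ->
  (forall i n, (i <= A)%nat -> nablan N (g i) n = 0) ->
  expands A (fun t => regsum p N c (h t)) (fun i => regsum p N c (g i)).
Proof.
  intros Hx; revert c h g; induction N as [|N IH]; intros c h g Hc He Hd Hz.
  - destruct Hd as (M & d & Hd & HM).
    destruct (zero_mean_bounded p c Hc) as (Mc & H0 & HMc).
    exists (Mc * M * Series (fun n => 1 / (INR n + x) ^ 2))%R, d.
    split; [exact Hd|]; intros t Ht.
    rewrite Csum_zero.
    + unfold Cminus; rewrite Copp_0, Cplus_0_r.
      assert (HB := Cmod_mult_decays x (M * t ^ S A) Mc c (h t) Hx H0 HMc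
                      (fun n => HM t n Ht)).
      eapply Rle_trans; [apply (CSeries_dominated _ _ HB)|].
      * apply ex_series_inv_sqr, Hx.
      * right; rewrite (Series_ext _
          (fun n => Mc * (M * t ^ S A) * (1 / (INR n + x) ^ 2))%R)
          by (intros; unfold Rdiv; ring).
        rewrite Series_scal_l; ring.
    + intros k Hk.
      rewrite (regsum_ext p 0 c (g k) (fun _ => 0)), (regsum_zero p 0); [ring|].
      intros n; apply (Hz k n); lia.
  - simpl; apply expands_plus; [apply expands_scal, He|].
    apply IH; auto using anti_zero_mean.
    intros n; apply expands_minus; apply He.
Qed.

(** * Functions of a real variable and the complex exponential *)

Definition is_cderive (F : R -> C) (y : R) (l : C) : Prop :=
  is_derive (fun t => Re (F t)) y (Re l) /\ is_derive (fun t => Im (F t)) y (Im l).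

Lemma is_derive_eq (F : R -> R) (y l m : R) : is_derive F y l -> l = m -> is_derive F y m.
Proof. intros H <-; exact H. Qed.

Lemma is_cderive_eq (F : R -> C) (y : R) (l m : C) :
  is_cderive F y l -> l = m -> is_cderive F y m.
Proof. intros H <-; exact H. Qed.

Lemma is_cderive_ext (F G : R -> C) (y : R) (l : C) :
  (forall t, F t = G t) -> is_cderive F y l -> is_cderive G y l.
Proof.
  intros E [H1 H2]; split;
    [apply (is_derive_ext (fun t => Re (F t)))|apply (is_derive_ext (fun t => Im (F t)))];
    auto; intros t; rewrite E; reflexivity.
Qed.

Lemma is_cderive_const (z : C) (y : R) : is_cderive (fun _ => z) y 0.
Proof.
  split; [change (is_derive (fun _ : R => Re z) y 0%R)
         |change (is_derive (fun _ : R => Im z) y 0%R)];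
    apply (is_derive_const (K := R_AbsRing) (V := R_NormedModule)).
Qed.

Lemma is_cderive_plus (F G : R -> C) (y : R) (l m : C) :
  is_cderive F y l -> is_cderive G y m -> is_cderive (fun t => F t + G t) y (l + m).
Proof.
  intros [H1 H2] [H3 H4]; split.
  - exact (is_derive_plus (K := R_AbsRing) (V := R_NormedModule) _ _ _ _ _ H1 H3).
  - exact (is_derive_plus (K := R_AbsRing) (V := R_NormedModule) _ _ _ _ _ H2 H4).
Qed.

Lemma is_cderive_mult (F G : R -> C) (y : R) (l m : C) :
  is_cderive F y l -> is_cderive G y m ->
  is_cderive (fun t => F t * G t) y (l * G y + F y * m).
Proof.
  intros [H1 H2] [H3 H4]; split.
  - eapply is_derive_eq.
    + exact (is_derive_minus (K := R_AbsRing) (V := R_NormedModule) _ _ _ _ _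
               (Derive.is_derive_mult _ _ _ _ _ H1 H3)
               (Derive.is_derive_mult _ _ _ _ _ H2 H4)).
    + unfold minus, plus, opp, Re, Im; simpl; unfold Re, Im; ring.
  - eapply is_derive_eq.
    + exact (is_derive_plus (K := R_AbsRing) (V := R_NormedModule) _ _ _ _ _
               (Derive.is_derive_mult _ _ _ _ _ H1 H4)
               (Derive.is_derive_mult _ _ _ _ _ H2 H3)).
    + unfold plus, Re, Im; simpl; unfold Re, Im; ring.
Qed.

Lemma is_cderive_scal (z : C) (F : R -> C) (y : R) (l : C) :
  is_cderive F y l -> is_cderive (fun t => z * F t) y (z * l).
Proof.
  intros H; eapply is_cderive_eq;
    [exact (is_cderive_mult _ _ _ _ _ (is_cderive_const z y) H)|cbv beta; ring].
Qed.

Lemma is_cderive_minus (F G : R -> C) (y : R) (l m : C) :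
  is_cderive F y l -> is_cderive G y m -> is_cderive (fun t => F t - G t) y (l - m).
Proof.
  intros HF HG.
  apply is_cderive_ext with (fun t => F t + (-1) * G t); [intros; ring|].
  eapply is_cderive_eq;
    [apply is_cderive_plus; [exact HF|apply is_cderive_scal, HG]|ring].
Qed.

Lemma is_cderive_comp (F : R -> C) (g : R -> R) (y dg : R) (l : C) :
  is_cderive F (g y) l -> is_derive g y dg ->
  is_cderive (fun t => F (g t)) y (RtoC dg * l).
Proof.
  intros [H1 H2] Hg; split; eapply is_derive_eq;
    [exact (is_derive_comp (K := R_AbsRing) (V := R_NormedModule) _ _ _ _ _ H1 Hg)|
    |exact (is_derive_comp (K := R_AbsRing) (V := R_NormedModule) _ _ _ _ _ H2 Hg)|];
    unfold scal; simpl; unfold mult; simpl; unfold Re, Im; ring.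
Qed.

Lemma is_cderive_RtoC (f : R -> R) (y l : R) :
  is_derive f y l -> is_cderive (fun t => RtoC (f t)) y (RtoC l).
Proof.
  intros H; split; [exact H|].
  change (is_derive (fun _ : R => 0%R) y 0%R).
  apply (is_derive_const (K := R_AbsRing) (V := R_NormedModule)).
Qed.

Lemma mean_value_bound (f df : R -> R) (a b M : R) :
  (a <= b)%R -> (forall t, (a <= t <= b)%R -> is_derive f t (df t)) ->
  (forall t, (a <= t <= b)%R -> (Rabs (df t) <= M)%R) ->
  (Rabs (f b - f a) <= M * (b - a))%R.
Proof.
  intros Hab Hd HM.
  destruct (MVT_gen f a b df) as (t & Ht & E).
  - rewrite Rmin_left, Rmax_right by exact Hab; intros t Ht; apply Hd; lra.
  - rewrite Rmin_left, Rmax_right by exact Hab; intros t Ht.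
    apply continuity_pt_filterlim.
    apply (ex_derive_continuous (K := R_AbsRing) (V := R_NormedModule)).
    exists (df t); apply Hd, Ht.
  - rewrite Rmin_left, Rmax_right in Ht by exact Hab.
    rewrite E, Rabs_mult, (Rabs_pos_eq (b - a)) by lra.
    apply Rmult_le_compat_r; [lra|apply HM, Ht].
Qed.

(** [F] is a tower of successive derivatives, and [F i y - F i (y + 1)] is again one; so the
    induction moves a difference inside the tower, and the mean value theorem trades it for a
    derivative. That theorem fails for complex values, hence the separate treatment of real and
    imaginary parts. *)
Lemma nablan_derive_bound_aux (N : nat) (F : nat -> R -> C) (x M : R) (n : nat) :
  (0 < x)%R ->
  (forall i y, (0 < y)%R -> is_cderive (F i) y (F (S i) y)) ->
  (forall y, (INR n + x <= y)%R ->
     (Rabs (Re (F N y)) <= M /\ Rabs (Im (F N y)) <= M)%R) ->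
  (Rabs (Re (nablan N (fun n => F O (INR n + x)%R) n)) <= M /\
   Rabs (Im (nablan N (fun n => F O (INR n + x)%R) n)) <= M)%R.
Proof.
  intros Hx; revert F; induction N as [|N IH]; intros F Hd HM.
  - apply HM; lra.
  - simpl nablan.
    rewrite (nablan_ext N _
      (fun n => (fun i y => F i y - F i (y + 1)%R) O (INR n + x)%R)).
    2:{ intros k; unfold nabla; cbv beta; rewrite S_INR; do 2 f_equal; ring. }
    apply (IH (fun i y => F i y - F i (y + 1)%R)).
    + intros i y Hy; apply is_cderive_minus; [apply Hd, Hy|].
      eapply is_cderive_eq.
      * apply (is_cderive_comp (F i) (fun t => t + 1)%R y 1); [apply Hd; lra|].
        auto_derive; [trivial|ring].
      * ring.
    + intros y Hy; pose proof (INR_shift_pos x n Hx).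
      assert (Hb : forall P : C -> R, (P = Re \/ P = Im) ->
                (Rabs (P (F N (y + 1)%R) - P (F N y)) <= M)%R).
      { intros P HP; replace M with (M * (y + 1 - y))%R by ring.
        apply mean_value_bound with
          (f := fun t => P (F N t)) (df := fun t => P (F (S N) t)); [lra| |].
        - intros t Ht; destruct (Hd N t ltac:(lra)); destruct HP as [-> | ->]; assumption.
        - intros t Ht; destruct (HM t ltac:(lra)); destruct HP as [-> | ->]; assumption. }
      split.
      * rewrite <- Rabs_Ropp.
        replace (- Re _)%R with (Re (F N (y + 1)%R) - Re (F N y))%R
          by (unfold Re; simpl; ring).
        apply Hb; auto.
      * rewrite <- Rabs_Ropp.
        replace (- Im _)%R with (Im (F N (y + 1)%R) - Im (F N y))%R
          by (unfold Im; simpl; ring).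
        apply Hb; auto.
Qed.

(** The factor [2] comes from adding the bounds for the real and imaginary parts. *)
Lemma nablan_derive_bound (N : nat) (F : nat -> R -> C) (x M : R) (n : nat) :
  (0 < x)%R ->
  (forall i y, (0 < y)%R -> is_cderive (F i) y (F (S i) y)) ->
  (forall y, (INR n + x <= y)%R -> (Cmod (F N y) <= M)%R) ->
  (Cmod (nablan N (fun n => F O (INR n + x)%R) n) <= 2 * M)%R.
Proof.
  intros Hx Hd HM.
  destruct (nablan_derive_bound_aux N F x M n Hx Hd) as [H1 H2].
  - intros y Hy; specialize (HM y Hy); split;
      (eapply Rle_trans; [|exact HM]); [apply Rabs_Re_le_Cmod|apply Rabs_Im_le_Cmod].
  - eapply Rle_trans; [apply Cmod_le_Re_Im|]; lra.
Qed.

(** * The complex exponential and its Taylor sums *)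

Lemma Cexp_plus (z w : C) : Cexp (z + w) = Cexp z * Cexp w.
Proof.
  destruct z as [a b], w as [c d]; unfold Cexp, Cmult, Cplus; simpl.
  rewrite exp_plus, cos_plus, sin_plus; f_equal; ring.
Qed.

Lemma Cexp_RtoC (u : R) : Cexp (RtoC u) = RtoC (exp u).
Proof. unfold Cexp, RtoC; simpl; rewrite cos_0, sin_0; f_equal; ring. Qed.

Lemma Cexp_0 : Cexp 0 = 1.
Proof. rewrite Cexp_RtoC, exp_0; reflexivity. Qed.

Lemma Cmod_Cexp (z : C) : Cmod (Cexp z) = exp (Re z).
Proof.
  unfold Cmod, Cexp; simpl.
  replace (_ + _)%R with ((exp (Re z))²).
  - apply sqrt_Rsqr; left; apply exp_pos.
  - pose proof (sin2_cos2 (Im z)) as H; unfold Rsqr in *.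
    replace (_ + _)%R with (exp (Re z) * exp (Re z)
      * (sin (Im z) * sin (Im z) + cos (Im z) * cos (Im z)))%R by ring.
    rewrite H; ring.
Qed.

Lemma Cexp_neq_0 (z : C) : Cexp z <> 0.
Proof.
  intros E; apply (f_equal Cmod) in E; rewrite Cmod_Cexp, Cmod_0 in E.
  pose proof (exp_pos (Re z)); lra.
Qed.

Lemma Cexp_opp (z : C) : Cexp (- z) = / Cexp z.
Proof.
  assert (E : Cexp (- z) * Cexp z = 1).
  { rewrite <- Cexp_plus, <- Cexp_0; f_equal; ring. }
  pose proof (Cexp_neq_0 z).
  replace (Cexp (- z)) with (Cexp (- z) * Cexp z * / Cexp z) by (field; assumption).
  rewrite E; ring.
Qed.

Lemma is_cderive_Cexp (z : C) (t : R) :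
  is_cderive (fun t => Cexp (z * RtoC t)) t (z * Cexp (z * RtoC t)).
Proof.
  destruct z as [a b]; split; unfold Cexp, Cmult, RtoC; simpl;
    unfold Re, Im; simpl; auto_derive; try trivial; unfold Rminus; ring.
Qed.

Definition exp_term (z : C) (k : nat) : C := z ^ k * RtoC (/ INR (fact k)).

Definition exp_sum (z : C) (K : nat) : C := Csum (exp_term z) K.

Lemma exp_term_S (z : C) (k : nat) :
  exp_term z (S k) = exp_term z k * (z * RtoC (/ INR (S k))).
Proof.
  unfold exp_term; rewrite Cpow_S, fact_simpl, mult_INR, Rinv_mult, RtoC_mult; ring.
Qed.

Lemma is_cderive_exp_term (z : C) (k : nat) (t : R) :
  is_cderive (fun t => exp_term (z * RtoC t) (S k)) t (z * exp_term (z * RtoC t) k).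
Proof.
  assert (Hlin : is_cderive (fun t => z * RtoC t) t z).
  { eapply is_cderive_eq;
      [apply is_cderive_scal, (is_cderive_RtoC (fun t => t) t 1);
       auto_derive; [trivial|ring]|ring]. }
  induction k as [|k IH].
  - apply is_cderive_ext with (fun t => z * RtoC t).
    + intros u; unfold exp_term; simpl; rewrite Rinv_1; ring.
    + eapply is_cderive_eq; [exact Hlin|].
      unfold exp_term; simpl; rewrite Rinv_1; ring.
  - apply is_cderive_ext with
      (fun t => (RtoC (/ INR (S (S k))) * exp_term (z * RtoC t) (S k)) * (z * RtoC t)).
    { intros u; rewrite (exp_term_S _ (S k)); ring. }
    eapply is_cderive_eq; [apply is_cderive_mult; [apply is_cderive_scal, IH|exact Hlin]|].
    cbv beta; replace (exp_term (z * RtoC t) (S k))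
      with (exp_term (z * RtoC t) k * (z * RtoC t) * RtoC (/ INR (S k)))
      by (rewrite exp_term_S; ring).
    assert (Hk : forall r : R, (0 < r)%R -> RtoC r <> 0).
    { intros r Hr E; apply RtoC_inj in E; lra. }
    pose proof (pos_INR k) as Hp.
    rewrite !S_INR, !RtoC_inv, !RtoC_plus by lra.
    field; split; rewrite <- ?RtoC_plus; apply Hk; lra.
Qed.

(** Differentiating a Taylor sum drops one term, hence [pred K]; since [pred 0 = 0], the empty sum
    fits as well. *)
Lemma is_cderive_exp_sum (z : C) (K : nat) (t : R) :
  is_cderive (fun t => exp_sum (z * RtoC t) K) t (z * exp_sum (z * RtoC t) (pred K)).
Proof.
  induction K as [|K IH].
  - apply is_cderive_ext with (fun _ => 0); [reflexivity|].
    eapply is_cderive_eq; [apply is_cderive_const|unfold exp_sum; simpl; ring].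
  - apply is_cderive_ext with
      (fun t => exp_sum (z * RtoC t) K + exp_term (z * RtoC t) K); [reflexivity|].
    destruct K as [|k].
    + eapply is_cderive_eq; [apply is_cderive_plus; [exact IH|]|].
      * apply is_cderive_ext with (fun _ => 1); [|apply is_cderive_const].
        intros u; unfold exp_term; simpl; rewrite Rinv_1; ring.
      * unfold exp_sum; simpl; ring.
    + eapply is_cderive_eq;
        [apply is_cderive_plus; [exact IH|apply is_cderive_exp_term]|].
      unfold exp_sum; simpl; ring.
Qed.

Lemma Cmod_exp_sum (z : C) (K : nat) : (Cmod (exp_sum z K) <= exp (Cmod z))%R.
Proof.
  destruct K as [|K]; [unfold exp_sum; simpl; rewrite Cmod_0; left; apply exp_pos|].
  eapply Rle_trans; [|apply (exp_ge_taylor (Cmod z) K (Cmod_ge_0 z))].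
  rewrite <- sum_n_Reals.
  apply Cmod_Csum_le; intros k; unfold exp_term.
  rewrite Cmod_mult, Cmod_pow, Cmod_R, Rabs_pos_eq; [apply Rle_refl|].
  left; apply Rinv_0_lt_compat, INR_fact_lt_0.
Qed.

(** Both [g + f] and [g - f] vanish at [0] and have nonnegative derivative, so they are nonnegative
    at [t]. *)
Lemma Rabs_le_of_derive (f df g dg : R -> R) (t : R) :
  (0 <= t)%R -> f 0%R = 0%R -> g 0%R = 0%R ->
  (forall s, (0 <= s <= t)%R ->
     is_derive f s (df s) /\ is_derive g s (dg s) /\ (Rabs (df s) <= dg s)%R) ->
  (Rabs (f t) <= g t)%R.
Proof.
  intros Ht Hf Hg H.
  assert (Hmono : forall h dh : R -> R, h 0%R = 0%R ->
            (forall s, (0 <= s <= t)%R -> is_derive h s (dh s) /\ (0 <= dh s)%R) ->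
            (0 <= h t)%R).
  { intros h dh H0 Hh.
    destruct (MVT_gen h 0 t dh) as (s & Hs & E).
    - rewrite Rmin_left, Rmax_right by exact Ht; intros s Hs; apply Hh; lra.
    - rewrite Rmin_left, Rmax_right by exact Ht; intros s Hs.
      apply continuity_pt_filterlim.
      apply (ex_derive_continuous (K := R_AbsRing) (V := R_NormedModule)).
      exists (dh s); apply Hh, Hs.
    - rewrite Rmin_left, Rmax_right in Hs by exact Ht.
      destruct (Hh s Hs); rewrite H0 in E; nra. }
  apply Rabs_le; split.
  - apply Rminus_le_0; replace (f t - - g t)%R with (g t + f t)%R by ring.
    apply (Hmono (fun s => g s + f s)%R (fun s => dg s + df s)%R); [lra|].
    intros s Hs; destruct (H s Hs) as (H1 & H2 & H3); split.
    + exact (is_derive_plus (K := R_AbsRing) (V := R_NormedModule) _ _ _ _ _ H2 H1).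
    + apply Rabs_le_between in H3; lra.
  - apply Rminus_le_0.
    apply (Hmono (fun s => g s - f s)%R (fun s => dg s - df s)%R); [lra|].
    intros s Hs; destruct (H s Hs) as (H1 & H2 & H3); split.
    + exact (is_derive_minus (K := R_AbsRing) (V := R_NormedModule) _ _ _ _ _ H2 H1).
    + apply Rabs_le_between in H3; lra.
Qed.

Lemma exp_sum_0 (K : nat) : exp_sum 0 (S K) = 1.
Proof.
  unfold exp_sum; induction K as [|K IH].
  - simpl; unfold exp_term; simpl; rewrite Rinv_1; ring.
  - change (Csum (exp_term 0) (S K) + exp_term 0 (S K) = 1).
    rewrite IH, exp_term_S; ring.
Qed.

(** The derivative of the remainder of order [S K] is [z] times the remainder of order [K], so the
    bound is integrated from [0]. Passing from the two parts to the modulus costs a factor [2] at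
    each step, whence [(2 * Cmod z * t) ^ K]; the factorial still wins. *)
Lemma exp_sum_remainder (z : C) (K : nat) (t : R) :
  (0 <= t <= 1)%R ->
  let M := (exp (Cmod z) * (2 * Cmod z * t) ^ K / INR (fact K))%R in
  (Rabs (Re (Cexp (z * RtoC t) - exp_sum (z * RtoC t) K)) <= M /\
   Rabs (Im (Cexp (z * RtoC t) - exp_sum (z * RtoC t) K)) <= M)%R.
Proof.
  revert t; induction K as [|K IH]; intros t Ht M.
  - assert (H : (Cmod (Cexp (z * RtoC t) - exp_sum (z * RtoC t) 0) <= M)%R).
    { unfold M, exp_sum; simpl Csum; simpl fact; simpl pow; rewrite Rmult_1_r.
      replace (Cexp (z * RtoC t) - 0) with (Cexp (z * RtoC t)) by ring.
      rewrite Cmod_Cexp; unfold Rdiv; simpl INR; rewrite Rinv_1, Rmult_1_r.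
      replace (Re (z * RtoC t)) with (Re z * t)%R by (destruct z; simpl; ring).
      pose proof (Rabs_Re_le_Cmod z) as H1; pose proof (Rle_abs (Re z)).
      pose proof (Rabs_pos (Re z)).
      destruct (Rle_lt_or_eq_dec (Re z * t) (Cmod z)) as [H2|H2]; [nra| |].
      - left; apply exp_increasing, H2.
      - rewrite H2; apply Rle_refl. }
    split; (eapply Rle_trans; [|exact H]); [apply Rabs_Re_le_Cmod|apply Rabs_Im_le_Cmod].
  - pose (D := fun s : R => z * (Cexp (z * RtoC s) - exp_sum (z * RtoC s) K)).
    pose (g := fun s : R => (exp (Cmod z) * (2 * Cmod z * s) ^ S K / INR (fact (S K)))%R).
    pose (dg := fun s : R =>
      (exp (Cmod z) * (2 * Cmod z) * (2 * Cmod z * s) ^ K / INR (fact K))%R).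
    assert (HD : forall s, is_cderive
              (fun s => Cexp (z * RtoC s) - exp_sum (z * RtoC s) (S K)) s (D s)).
    { intros s; eapply is_cderive_eq;
        [apply is_cderive_minus; [apply is_cderive_Cexp|apply is_cderive_exp_sum]|].
      unfold D; simpl pred; ring. }
    assert (Hg : forall s, is_derive g s (dg s)).
    { intros s; unfold g, dg.
      assert (Hpow : forall E m F : R, is_derive
                (fun s => E * (m * s) ^ S K / F)%R s
                (E * (INR (S K) * m * (m * s) ^ K) / F)%R).
      { intros E m F; unfold Rdiv; auto_derive; [trivial|].
        change (match K with O => 1 | S _ => INR K + 1 end)%R with (INR (S K)); ring. }
      eapply is_derive_eq; [apply Hpow|].
      rewrite fact_simpl, mult_INR.
      field; split; [apply INR_fact_neq_0|apply not_0_INR; lia]. }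
    assert (HB : forall s, (0 <= s <= t)%R -> (Cmod (D s) <= dg s)%R).
    { intros s Hs; destruct (IH s ltac:(lra)) as [H1 H2].
      unfold D, dg; rewrite Cmod_mult.
      pose proof (Cmod_le_Re_Im (Cexp (z * RtoC s) - exp_sum (z * RtoC s) K)).
      replace (exp (Cmod z) * (2 * Cmod z) * (2 * Cmod z * s) ^ K / INR (fact K))%R
        with (Cmod z * (2 * (exp (Cmod z) * (2 * Cmod z * s) ^ K / INR (fact K))))%R
        by (unfold Rdiv; ring).
      apply Rmult_le_compat_l; [apply Cmod_ge_0|lra]. }
    assert (H0 : Cexp (z * RtoC 0) - exp_sum (z * RtoC 0) (S K) = 0).
    { replace (z * RtoC 0) with (RtoC 0) by ring; rewrite Cexp_0, exp_sum_0; ring. }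
    assert (Hg0 : g 0%R = 0%R).
    { unfold g; rewrite Rmult_0_r, pow_i by lia; unfold Rdiv; ring. }
    split.
    + apply (Rabs_le_of_derive
        (fun s => Re (Cexp (z * RtoC s) - exp_sum (z * RtoC s) (S K)))
        (fun s => Re (D s)) g dg); [lra| |exact Hg0|].
      * cbv beta; rewrite H0; reflexivity.
      * intros s Hs; split; [apply HD|split; [apply Hg|]].
        eapply Rle_trans; [apply Rabs_Re_le_Cmod|apply HB, Hs].
    + apply (Rabs_le_of_derive
        (fun s => Im (Cexp (z * RtoC s) - exp_sum (z * RtoC s) (S K)))
        (fun s => Im (D s)) g dg); [lra| |exact Hg0|].
      * cbv beta; rewrite H0; reflexivity.
      * intros s Hs; split; [apply HD|split; [apply Hg|]].
        eapply Rle_trans; [apply Rabs_Im_le_Cmod|apply HB, Hs].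
Qed.

Lemma Csums_Cexp (z : C) : Csums (exp_term z) (Cexp z).
Proof.
  unfold Csums.
  apply is_lim_seq_0_bound with
    (fun K => 2 * exp (Cmod z) * ((2 * Cmod z) ^ K / INR (fact K)))%R.
  - intros K; split; [apply Cmod_ge_0|].
    rewrite Cmod_minus_sym.
    destruct (exp_sum_remainder z K 1 ltac:(lra)) as [H1 H2].
    replace (z * RtoC 1) with z in * by ring.
    eapply Rle_trans; [apply Cmod_le_Re_Im|].
    unfold exp_sum in *; rewrite Rmult_1_r in *.
    replace (2 * exp (Cmod z) * ((2 * Cmod z) ^ K / INR (fact K)))%R
      with (exp (Cmod z) * (2 * Cmod z) ^ K / INR (fact K) +
            exp (Cmod z) * (2 * Cmod z) ^ K / INR (fact K))%R
      by (unfold Rdiv; ring).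
    lra.
  - replace 0%R with (2 * exp (Cmod z) * 0)%R by ring.
    apply (is_lim_seq_scal_l _ (2 * exp (Cmod z)) 0%R).
    apply is_lim_seq_Reals, cv_speed_pow_fact.
Qed.

(** * Analytic continuation of the Dirichlet series *)

(* Partial sums in [w] of the Taylor expansion of [y ^ (- (s + w))]. *)
Definition truncated_power (s w : C) (K : nat) (y : R) : C :=
  Cexp (- s * RtoC (ln y)) * exp_sum (- w * RtoC (ln y)) K.

Lemma Cexp_ln_shift (s : C) (y : R) :
  (0 < y)%R -> Cexp (- (s + 1) * RtoC (ln y)) = Cexp (- s * RtoC (ln y)) * RtoC (/ y).
Proof.
  intros Hy.
  replace (- (s + 1) * RtoC (ln y)) with (- s * RtoC (ln y) + RtoC (- ln y)).
  - rewrite Cexp_plus, Cexp_RtoC, exp_Ropp, exp_ln by exact Hy; reflexivity.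
  - rewrite RtoC_opp; ring.
Qed.

Lemma is_cderive_truncated_power (s w : C) (K : nat) (y : R) :
  (0 < y)%R ->
  is_cderive (truncated_power s w K) y
    (- s * truncated_power (s + 1) w K y
     + - w * truncated_power (s + 1) w (pred K) y).
Proof.
  intros Hy; unfold truncated_power; rewrite !(Cexp_ln_shift s y Hy).
  eapply is_cderive_eq.
  - apply (is_cderive_comp
      (fun t => Cexp (- s * RtoC t) * exp_sum (- w * RtoC t) K) ln y (/ y)).
    + apply is_cderive_mult; [apply is_cderive_Cexp|apply is_cderive_exp_sum].
    + apply is_derive_ln, Hy.
  - cbv beta; ring.
Qed.

(** Each derivative in [y] raises [s] by one, which absorbs the factor [/ y] from [ln], and branches
    on the truncation index because differentiating the truncated exponential loses a term. *)
Fixpoint truncated_power_derive (w : C) (N : nat) (s : C) (K : nat) (y : R) : C :=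
  match N with
  | O => truncated_power s w K y
  | S k => - s * truncated_power_derive w k (s + 1) K y
           + - w * truncated_power_derive w k (s + 1) (pred K) y
  end.

Lemma is_cderive_truncated_power_derive (w : C) (N : nat) (s : C) (K : nat) (y : R) :
  (0 < y)%R ->
  is_cderive (truncated_power_derive w N s K) y (truncated_power_derive w (S N) s K y).
Proof.
  intros Hy; revert s K; induction N as [|N IH]; intros s K.
  - apply is_cderive_truncated_power, Hy.
  - apply (is_cderive_plus (fun y => - s * truncated_power_derive w N (s + 1) K y)
             (fun y => - w * truncated_power_derive w N (s + 1) (pred K) y));
      apply is_cderive_scal, IH.
Qed.

(** Each derivative multiplies the bound by at most [Cmod w] plus the modulus of the current [s],
    which has grown by at most one per earlier step; [M] dominates all these factors. Uniformity in
    [K] holds because every Taylor sum of the exponential is bounded by [exp] of the modulus. *)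
Lemma truncated_power_derive_bound (w : C) (N : nat) (s : C) (K : nat) (y M : R) :
  (0 < y)%R -> (Cmod s + INR N + Cmod w <= M)%R ->
  (Cmod (truncated_power_derive w N s K y)
   <= M ^ N * (exp (- (Re s + INR N) * ln y) * exp (Cmod w * Rabs (ln y))))%R.
Proof.
  intros Hy; revert s K; induction N as [|N IH]; intros s K HM.
  - simpl; unfold truncated_power; rewrite Cmod_mult, Cmod_Cexp, Rmult_1_l.
    replace (Re (- s * RtoC (ln y))) with (- (Re s + 0) * ln y)%R
      by (destruct s; simpl; ring).
    apply Rmult_le_compat_l; [left; apply exp_pos|].
    eapply Rle_trans; [apply Cmod_exp_sum|].
    rewrite Cmod_mult, Cmod_opp, Cmod_R; apply Rle_refl.
  - rewrite S_INR in *.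
    assert (Hs : (Cmod (s + 1) + INR N + Cmod w <= M)%R).
    { pose proof (Cmod_triangle s 1) as H; rewrite Cmod_1 in H; lra. }
    pose proof (IH (s + 1) K Hs) as H1; pose proof (IH (s + 1) (pred K) Hs) as H2.
    replace (Re (s + 1) + INR N)%R with (Re s + (INR N + 1))%R in H1, H2
      by (unfold Re; simpl; ring).
    match type of H1 with (_ <= ?B)%R => set (b := B) in * end.
    simpl truncated_power_derive; simpl pow.
    eapply Rle_trans; [apply Cmod_triangle|]; rewrite !Cmod_mult, !Cmod_opp.
    rewrite Rmult_assoc; fold b.
    pose proof (Cmod_ge_0 s); pose proof (Cmod_ge_0 w); pose proof (pos_INR N).
    assert (Hb : (0 <= b)%R) by (eapply Rle_trans; [apply Cmod_ge_0|exact H1]).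
    apply Rle_trans with (Cmod s * b + Cmod w * b)%R; [|nra].
    apply Rplus_le_compat; apply Rmult_le_compat_l; assumption.
Qed.

(** Perturbing an exponent by at most one costs at most one power of [y]. For [y >= 1] this is
    clear; for [x <= y < 1] it uses [/ y <= y / x ^ 2]. *)
Lemma exp_abs_ln_le (x y u : R) :
  (0 < x <= y)%R -> (0 <= u <= 1)%R ->
  (exp (u * Rabs (ln y)) <= (1 + / x ^ 2) * y)%R.
Proof.
  intros Hy Hu.
  apply Rle_trans with (exp (Rabs (ln y))).
  - pose proof (Rabs_pos (ln y)).
    destruct (Rle_lt_or_eq_dec (u * Rabs (ln y)) (Rabs (ln y))) as [H1|H1]; [nra| |].
    + left; apply exp_increasing, H1.
    + rewrite H1; apply Rle_refl.
  - assert (Hx2 : (0 < / x ^ 2)%R) by (apply Rinv_0_lt_compat; nra).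
    unfold Rabs; destruct (Rcase_abs (ln y)).
    + rewrite exp_Ropp, exp_ln by lra.
      apply Rle_trans with (/ x ^ 2 * y)%R; [|nra].
      replace (/ y)%R with (/ y ^ 2 * y)%R by (field; lra).
      apply Rmult_le_compat_r; [lra|]; apply inv_sqr_le, Hy.
    + rewrite exp_ln by lra; nra.
Qed.

Lemma exp_ln_antitone (x y e : R) :
  (0 < x <= y)%R -> (0 <= e)%R -> (exp (- e * ln y) <= exp (- e * ln x))%R.
Proof.
  intros Hy He; pose proof (ln_le x y ltac:(lra) ltac:(lra)).
  destruct (Rle_lt_or_eq_dec (- e * ln y) (- e * ln x)) as [H1|H1]; [nra| |].
  - left; apply exp_increasing, H1.
  - rewrite H1; apply Rle_refl.
Qed.

(** Of the exponent [3], two units give the square in the denominator and one absorbs the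
    perturbation by [w]. The constant is independent of [K], as [regsum_lim] requires. *)
Lemma truncated_power_decays (s w : C) (N : nat) (x : R) :
  (0 < x)%R -> (Cmod w <= 1)%R -> (3 <= Re s + INR N)%R ->
  exists M, forall K n,
    (Cmod (nablan N (fun n => truncated_power s w K (INR n + x)%R) n)
     <= M / (INR n + x) ^ 2)%R.
Proof.
  intros Hx Hw HN.
  pose (M0 := ((Cmod s + INR N + Cmod w) ^ N)%R).
  pose (e := (Re s + INR N - 3)%R).
  pose (B := (M0 * (exp (- e * ln x) * (1 + / x ^ 2)))%R).
  assert (HM0 : (0 <= M0)%R).
  { apply pow_le; pose proof (Cmod_ge_0 s); pose proof (Cmod_ge_0 w);
      pose proof (pos_INR N); lra. }
  assert (Hx2 : (0 < / x ^ 2)%R) by (apply Rinv_0_lt_compat; nra).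
  assert (HB : (0 <= B)%R).
  { apply Rmult_le_pos; [exact HM0|]; pose proof (exp_pos (- e * ln x)).
    apply Rmult_le_pos; lra. }
  exists (2 * B)%R; intros K n; pose proof (INR_shift_pos x n Hx).
  replace (2 * B / (INR n + x) ^ 2)%R with (2 * (B / (INR n + x) ^ 2))%R
    by (unfold Rdiv; ring).
  apply (nablan_derive_bound N (fun i => truncated_power_derive w i s K)); [exact Hx| |].
  - intros i y Hy; apply is_cderive_truncated_power_derive, Hy.
  - intros y Hy.
    eapply Rle_trans;
      [apply truncated_power_derive_bound; [lra|apply Rle_refl]|].
    apply Rle_trans with (B / y ^ 2)%R.
    + replace (B / y ^ 2)%R
        with (M0 * (exp (- e * ln x) * (1 + / x ^ 2) / y ^ 2))%R
        by (unfold B, Rdiv; ring).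
      apply Rmult_le_compat_l; [exact HM0|].
      assert (Hxy : (x <= y)%R) by (pose proof (pos_INR n); lra).
      pose proof (exp_ln_antitone x y e ltac:(lra) ltac:(unfold e; lra)) as H1.
      pose proof (exp_abs_ln_le x y (Cmod w) ltac:(lra)
                    (conj (Cmod_ge_0 w) Hw)) as H2.
      replace (- (Re s + INR N) * ln y)%R
        with (- e * ln y + (- ln y + (- ln y + - ln y)))%R by (unfold e; ring).
      rewrite !exp_plus, !exp_Ropp, exp_ln by lra.
      replace (exp (- e * ln x) * (1 + / x ^ 2) / y ^ 2)%R
        with (exp (- e * ln x) * (/ y * (/ y * / y)) * ((1 + / x ^ 2) * y))%R
        by (field; lra).
      apply Rmult_le_compat; [| | |exact H2].
      * apply Rmult_le_pos; [left; apply exp_pos|].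
        assert (0 < / y)%R by (apply Rinv_0_lt_compat; lra); nra.
      * left; apply exp_pos.
      * apply Rmult_le_compat_r; [|exact H1].
        assert (0 < / y)%R by (apply Rinv_0_lt_compat; lra); nra.
    + apply Rmult_le_compat_l; [exact HB|]; apply inv_sqr_le; lra.
Qed.

Lemma Cpow_pos_opp_plus (s w : C) (y : R) :
  Cpow_pos y (- (s + w)) = Cexp (- s * RtoC (ln y)) * Cexp (- w * RtoC (ln y)).
Proof. unfold Cpow_pos; rewrite <- Cexp_plus; f_equal; ring. Qed.

Lemma truncated_power_lim (s w : C) (y : R) :
  is_lim_seq (fun K => Cmod (truncated_power s w K y - Cpow_pos y (- (s + w)))) 0%R.
Proof.
  rewrite Cpow_pos_opp_plus; unfold truncated_power.
  apply is_lim_seq_ext with (fun K => Cmod (Cexp (- s * RtoC (ln y))) *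
     Cmod (exp_sum (- w * RtoC (ln y)) K - Cexp (- w * RtoC (ln y))))%R.
  - intros K; rewrite <- Cmod_mult; f_equal; ring.
  - replace 0%R with (Cmod (Cexp (- s * RtoC (ln y))) * 0)%R by ring.
    apply (is_lim_seq_scal_l _ (Cmod (Cexp (- s * RtoC (ln y)))) 0%R), Csums_Cexp.
Qed.

(** The Taylor coefficients at [s] of the power [y ^ (- s)] as a function of [s], namely
    [y ^ (- s) * (- ln y) ^ k / k!]. *)
Definition power_coeff (s : C) (k : nat) (y : R) : C :=
  Cexp (- s * RtoC (ln y)) * exp_term (- RtoC (ln y)) k.

Lemma truncated_power_S (s w : C) (K : nat) (y : R) :
  truncated_power s w (S K) y = truncated_power s w K y + w ^ K * power_coeff s K y.
Proof.
  unfold truncated_power, power_coeff, exp_sum; simpl Csum; unfold exp_term.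
  replace (- w * RtoC (ln y)) with (w * - RtoC (ln y)) by ring.
  rewrite Cpow_mult_l; ring.
Qed.

Lemma decays_plus (x : R) (N : nat) (g h : nat -> C) :
  decays x N g -> decays x N h -> decays x N (fun n => g n + h n).
Proof.
  intros (M1 & H1) (M2 & H2); exists (M1 + M2)%R; intros n.
  rewrite (nablan_ext N _ (fun n => g n - (-1) * h n)) by (intros; ring).
  rewrite nablan_minus, nablan_scal.
  replace (nablan N g n - -1 * nablan N h n) with (nablan N g n + nablan N h n) by ring.
  eapply Rle_trans; [apply Cmod_triangle|].
  specialize (H1 n); specialize (H2 n); unfold Rdiv in *; lra.
Qed.

Lemma decays_ext (x : R) (N : nat) (g h : nat -> C) :
  (forall n, g n = h n) -> decays x N g -> decays x N h.
Proof.
  intros E (M & H); exists M; intros n; rewrite <- (nablan_ext N g h E); apply H.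
Qed.

(** A coefficient is the difference of two consecutive truncations at [w = 1], so the uniform bound
    for truncations covers it without a further estimate of derivatives. *)
Lemma power_coeff_decays (s : C) (k N : nat) (x : R) :
  (0 < x)%R -> (3 <= Re s + INR N)%R ->
  decays x N (fun n => power_coeff s k (INR n + x)%R).
Proof.
  intros Hx HN.
  destruct (truncated_power_decays s 1 N x Hx) as (M & HM);
    [rewrite Cmod_1; lra|exact HN|].
  apply decays_ext with (fun n => truncated_power s 1 (S k) (INR n + x)%R
                           + (-1) * truncated_power s 1 k (INR n + x)%R).
  - intros n; rewrite truncated_power_S, Cpow_1_l; ring.
  - apply decays_plus; [|apply decays_scal]; exists M; apply HM.
Qed.

Definition shifted_power (x : R) (s : C) (n : nat) : C := Cpow_pos (INR n + x) (- s).

Lemma regsum_truncated_power (p N : nat) (x : R) (c : nat -> C) (s w : C) (K : nat) :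
  (0 < x)%R -> zero_mean p c -> (3 <= Re s + INR N)%R ->
  decays x N (fun n => truncated_power s w K (INR n + x)%R) /\
  regsum p N c (fun n => truncated_power s w K (INR n + x)%R) =
  Csum (fun k => w ^ k * regsum p N c (fun n => power_coeff s k (INR n + x)%R)) K.
Proof.
  intros Hx Hc HN; induction K as [|K [IHd IH]].
  - assert (E : forall n, RtoC 0 = truncated_power s w 0 (INR n + x)%R)
      by (intros n; unfold truncated_power, exp_sum; simpl; ring).
    split.
    + apply (decays_ext x N _ _ E); exists 0%R; intros n.
      rewrite (nablan_ext N _ (fun n => 0 * 0)) by (intros; ring).
      rewrite nablan_scal, Cmult_0_l, Cmod_0; unfold Rdiv; lra.
    + rewrite <- (regsum_ext p N c _ _ E), regsum_zero; reflexivity.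
  - assert (E : forall n, truncated_power s w K (INR n + x)%R
                  + w ^ K * power_coeff s K (INR n + x)%R
                  = truncated_power s w (S K) (INR n + x)%R)
      by (intros; symmetry; apply truncated_power_S).
    pose proof (power_coeff_decays s K N x Hx HN) as Hd.
    split.
    + apply (decays_ext x N _ _ E), decays_plus; [|apply decays_scal]; assumption.
    + rewrite <- (regsum_ext p N c _ _ E), (regsum_plus p N x);
        auto using decays_scal.
      rewrite (regsum_scal p N x), IH; auto.
Qed.

(** The limit in [K] of the identity for truncations, which is the Taylor expansion at [s] of the
    regularised sum. The radius is one because the uniform domination is available for
    [Cmod w <= 1]. *)
Lemma regsum_shifted_power_series (p N : nat) (x : R) (c : nat -> C) (s w : C) :
  (0 < x)%R -> zero_mean p c -> (3 <= Re s + INR N)%R -> (Cmod w <= 1)%R ->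
  decays x N (shifted_power x (s + w)) /\
  Csums (fun k => w ^ k * regsum p N c (fun n => power_coeff s k (INR n + x)%R))
    (regsum p N c (shifted_power x (s + w))).
Proof.
  intros Hx Hc HN Hw.
  destruct (truncated_power_decays s w N x Hx Hw HN) as (M & HM).
  destruct (regsum_lim p N x M c
              (fun K n => truncated_power s w K (INR n + x)%R)
              (shifted_power x (s + w)) Hx Hc HM) as [Hd Hl].
  { intros n; apply truncated_power_lim. }
  split; [exact Hd|]; unfold Csums.
  apply is_lim_seq_ext with (2 := Hl); intros K.
  rewrite (proj2 (regsum_truncated_power p N x c s w K Hx Hc HN)); reflexivity.
Qed.

Lemma shifted_power_decays (N : nat) (x : R) (s : C) :
  (0 < x)%R -> (3 <= Re s + INR N)%R -> decays x N (shifted_power x s).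
Proof.
  intros Hx HN.
  replace s with (s + 0) by ring.
  (* Only the decay half is extracted, with the zero sequence of period [1] as a placeholder and
     [w = 0]. *)
  apply (regsum_shifted_power_series 1 N x (fun _ => 0)); auto.
  - repeat split; auto; simpl; ring.
  - rewrite Cmod_0; lra.
Qed.

(** [up] gives an integer above [3 - Re s], and [Z.to_nat] replaces a negative one by [0], which is
    then enough. The number of summations by parts varies with [s], but by [regsum_indep] any other
    admissible number gives the same value. *)
Definition continuation (p : nat) (c : nat -> C) (x : R) (s : C) : C :=
  regsum p (Z.to_nat (up (3 - Re s))) c (shifted_power x s).

Lemma INR_to_nat_up (u : R) : (u <= INR (Z.to_nat (up u)))%R.
Proof.
  destruct (archimed u) as [H _].
  destruct (Z_le_gt_dec 0 (up u)) as [Hz|Hz].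
  - rewrite INR_IZR_INZ, Z2Nat.id by exact Hz; lra.
  - pose proof (pos_INR (Z.to_nat (up u))).
    assert (IZR (up u) <= 0)%R by (apply IZR_le; lia); lra.
Qed.

Lemma regsum_indep (p N M : nat) (x : R) (c h : nat -> C) :
  (0 < x)%R -> zero_mean p c -> decays x N h -> decays x M h ->
  regsum p N c h = regsum p M c h.
Proof.
  intros Hx Hc HN HM.
  rewrite <- (regsum_le p N (max N M) x), <- (regsum_le p M (max N M) x);
    auto using Nat.le_max_l, Nat.le_max_r.
Qed.

Lemma continuation_regsum (p N : nat) (c : nat -> C) (x : R) (s : C) :
  (0 < x)%R -> zero_mean p c -> decays x N (shifted_power x s) ->
  continuation p c x s = regsum p N c (shifted_power x s).
Proof.
  intros Hx Hc HN; apply regsum_indep with x; auto.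
  apply shifted_power_decays; [exact Hx|].
  pose proof (INR_to_nat_up (3 - Re s)); lra.
Qed.

Lemma pow_n_Cpow (z : C) (n : nat) : pow_n (K := C_Ring) z n = z ^ n.
Proof. induction n as [|n IH]; [reflexivity|]; simpl; rewrite IH; reflexivity. Qed.

Lemma is_pseries_Csums (a : nat -> C) (z l : C) :
  is_pseries (K := C_AbsRing) (V := C_NormedModule) a z l <->
  Csums (fun k => z ^ k * a k) l.
Proof.
  unfold is_pseries; rewrite is_series_Csums.
  split; apply Csums_ext; intros n; rewrite <- pow_n_Cpow; reflexivity.
Qed.

Lemma continuation_entire (p : nat) (c : nat -> C) (x : R) (z : C) :
  (0 < x)%R -> zero_mean p c -> entire (fun s => z * continuation p c x s).
Proof.
  intros Hx Hc s0.
  (* [4] instead of [3]: within the unit disc around [s0] the real part drops by less than one, so a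
     single [N] serves the whole disc. *)
  pose (N := Z.to_nat (up (4 - Re s0))).
  assert (HN : (4 - Re s0 <= INR N)%R) by apply INR_to_nat_up.
  exists (fun k => z * regsum p N c (fun n => power_coeff s0 k (INR n + x)%R)), 1%R.
  split; [lra|]; intros s Hs.
  apply is_pseries_Csums.
  destruct (regsum_shifted_power_series p N x c s0 (s - s0)) as [_ H];
    [exact Hx|exact Hc|lra|lra|].
  replace (s0 + (s - s0)) with s in H by ring.
  rewrite (continuation_regsum p N); auto.
  - apply (Csums_scal z) in H; revert H; apply Csums_ext; intros; ring.
  - apply shifted_power_decays; [exact Hx|].
    pose proof (Rabs_Re_le_Cmod (s - s0)) as H1.
    replace (Re (s - s0)) with (Re s - Re s0)%R in H1 by reflexivity.
    pose proof (Rabs_def2 _ _ (Rle_lt_trans _ _ _ H1 Hs)); lra.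
Qed.

Lemma vanishes_of_inv_bound (x M : R) (h : nat -> C) :
  (0 < x)%R -> (forall n, Cmod (h n) <= M / (INR n + x))%R -> vanishes h.
Proof.
  intros Hx H.
  apply is_lim_seq_0_bound with (fun n => M * / (INR n + x))%R.
  - intros n; split; [apply Cmod_ge_0|apply H].
  - replace 0%R with (M * 0)%R by ring; apply (is_lim_seq_scal_l _ M 0%R).
    apply (is_lim_seq_inv _ p_infty); [|discriminate].
    apply is_lim_seq_plus with p_infty x;
      [apply is_lim_seq_INR|apply is_lim_seq_const|reflexivity].
Qed.

Lemma continuation_CSeries (p : nat) (c : nat -> C) (x : R) (s : C) :
  (0 < x)%R -> zero_mean p c -> (1 < Re s)%R ->
  continuation p c x s = CSeries (fun n => c n / Cpow_pos (INR n + x) s).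
Proof.
  intros Hx Hc Hs; symmetry; apply CSeries_unique.
  apply Csums_ext with (fun n => c n * shifted_power x s n).
  - intros n; unfold shifted_power, Cpow_pos, Cdiv.
    rewrite <- Cexp_opp; do 2 f_equal; ring.
  - apply Csums_regsum with x; auto.
    (* With [y = n + x] the modulus is [y ^ (- (Re s - 1)) / y], and the first factor is largest at
       [y = x]. *)
    + apply vanishes_of_inv_bound with x (exp (- (Re s - 1) * ln x)); [exact Hx|].
      intros n; pose proof (INR_shift_pos x n Hx); unfold shifted_power, Cpow_pos.
      rewrite Cmod_Cexp.
      replace (Re (- s * RtoC (ln (INR n + x))))
        with (- (Re s - 1) * ln (INR n + x) + - ln (INR n + x))%R
        by (destruct s; simpl; ring).
      rewrite exp_plus, exp_Ropp, exp_ln by assumption.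
      apply Rmult_le_compat_r; [left; apply Rinv_0_lt_compat; assumption|].
      apply exp_ln_antitone; [pose proof (pos_INR n)|]; lra.
    + apply shifted_power_decays; [exact Hx|].
      pose proof (INR_to_nat_up (3 - Re s)); lra.
Qed.

(** * Monomials and the values at nonpositive integers *)

Fixpoint monomial_derive (i m : nat) (y : R) : R :=
  match i with
  | O => y ^ m
  | S k => INR m * monomial_derive k (pred m) y
  end.

Lemma is_derive_monomial_derive (i m : nat) (y : R) :
  is_derive (monomial_derive i m) y (monomial_derive (S i) m y).
Proof.
  revert m; induction i as [|i IH]; intros m.
  - change (is_derive (fun y => y ^ m)%R y (INR m * y ^ pred m)%R).
    eapply is_derive_eq;
      [apply (is_derive_pow (fun t => t) m y 1); auto_derive; [trivial|ring]|ring].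
  - apply (is_derive_scal (monomial_derive i (pred m)) y (INR m)), IH.
Qed.

Lemma monomial_derive_0 (i m : nat) (y : R) : (m < i)%nat -> monomial_derive i m y = 0%R.
Proof.
  revert m; induction i as [|i IH]; intros m Hm; [lia|]; simpl.
  destruct m as [|m]; [simpl; ring|rewrite IH by (simpl; lia); ring].
Qed.

Definition monomial (x : R) (m : nat) : nat -> C := fun n => RtoC ((INR n + x) ^ m)%R.

(** The derivative of order [N] is identically zero, so the derivative bound applies with constant
    [0]. *)
Lemma nablan_monomial (N m : nat) (x : R) (n : nat) :
  (0 < x)%R -> (m < N)%nat -> nablan N (monomial x m) n = 0.
Proof.
  intros Hx Hm; apply Cmod_eq_0, Rle_antisym; [|apply Cmod_ge_0].
  replace 0%R with (2 * 0)%R by ring.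
  apply (nablan_derive_bound N (fun i y => RtoC (monomial_derive i m y))); [exact Hx| |].
  - intros i y _; apply is_cderive_RtoC, is_derive_monomial_derive.
  - intros y _; rewrite monomial_derive_0, Cmod_0 by exact Hm; lra.
Qed.

Lemma monomial_decays (N m : nat) (x : R) :
  (0 < x)%R -> (m < N)%nat -> decays x N (monomial x m).
Proof.
  intros Hx Hm; exists 0%R; intros n; rewrite nablan_monomial, Cmod_0 by assumption.
  unfold Rdiv; lra.
Qed.

Lemma shifted_power_neg_nat (x : R) (m n : nat) :
  (0 < x)%R -> monomial x m n = shifted_power x (RtoC (- INR m)) n.
Proof.
  intros Hx; pose proof (INR_shift_pos x n Hx); unfold shifted_power, Cpow_pos, monomial.
  replace (- RtoC (- INR m) * RtoC (ln (INR n + x)))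
    with (RtoC (INR m * ln (INR n + x)))
    by (rewrite RtoC_opp, RtoC_mult; ring).
  rewrite Cexp_RtoC; f_equal.
  rewrite <- Rpower_pow by assumption; reflexivity.
Qed.

(** [N > m] is enough here, below the generic [N >= m + 3], because the remainder is zero. Since
    every such [N] is allowed, the number of summations chosen for the theta series can be
    reused. *)
Lemma continuation_neg_nat (p : nat) (c : nat -> C) (x : R) (m N : nat) :
  (0 < x)%R -> zero_mean p c -> (m < N)%nat ->
  regsum p N c (monomial x m) = continuation p c x (RtoC (- INR m)).
Proof.
  intros Hx Hc Hm.
  assert (E := fun n => shifted_power_neg_nat x m n Hx).
  rewrite (continuation_regsum p N); auto.
  - apply regsum_ext, E.
  - apply (decays_ext x N _ _ E), monomial_decays; assumption.
Qed.

(** * The theta series *)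

(** With [v = t * y ^ r] this is [y ^ (- m) * v ^ j * exp (- v)]. The span of this family is closed
    under differentiation in [y], and [v ^ j * exp (- v)] is bounded uniformly in positive [t] and
    [y]. *)
Definition theta_monomial (t : R) (r m j : nat) (y : R) : R :=
  (/ y ^ m * ((t * y ^ r) ^ j * exp (- (t * y ^ r))))%R.

Lemma is_derive_pow_div (k : nat) (y : R) :
  y <> 0%R -> is_derive (fun y => y ^ k)%R y (INR k * y ^ k / y)%R.
Proof.
  intros Hy; eapply is_derive_eq;
    [apply (is_derive_pow (fun t => t) k y 1); auto_derive; [trivial|ring]|].
  destruct k as [|k]; [simpl; field; exact Hy|].
  change (pred (S k)) with k; rewrite <- (tech_pow_Rmult y k); field; exact Hy.
Qed.

Lemma is_derive_theta_monomial (t : R) (r m j : nat) (y : R) :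
  (0 < t)%R -> (0 < y)%R ->
  is_derive (theta_monomial t r m j) y
    ((INR r * INR j - INR m) * theta_monomial t r (S m) j y
     - INR r * theta_monomial t r (S m) (S j) y)%R.
Proof.
  intros Ht Hy; unfold theta_monomial.
  assert (Hyr : (0 < y ^ r)%R) by (apply pow_lt, Hy).
  assert (Hym : (0 < y ^ m)%R) by (apply pow_lt, Hy).
  assert (Hv : is_derive (fun y => t * y ^ r)%R y (INR r * (t * y ^ r) / y)%R).
  { eapply is_derive_eq;
      [apply (is_derive_scal (fun y => y ^ r)%R y t), is_derive_pow_div; lra|].
    field; lra. }
  assert (He : is_derive (fun v => v ^ j * exp (- v))%R (t * y ^ r)%R
            ((INR j * (t * y ^ r) ^ j / (t * y ^ r) - (t * y ^ r) ^ j)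
             * exp (- (t * y ^ r)))%R).
  { eapply is_derive_eq;
      [apply (Derive.is_derive_mult (fun v => v ^ j)%R (fun v => exp (- v)));
       [apply is_derive_pow_div; nra|auto_derive; [trivial|reflexivity]]|].
    field; split; lra. }
  eapply is_derive_eq.
  - apply (Derive.is_derive_mult (fun y => / y ^ m)%R
             (fun y => (t * y ^ r) ^ j * exp (- (t * y ^ r)))%R).
    + apply (is_derive_inv (fun y => y ^ m)%R);
        [apply is_derive_pow_div; lra|lra].
    + exact (is_derive_comp (K := R_AbsRing) (V := R_NormedModule) _ _ _ _ _ He Hv).
  - unfold scal; simpl; unfold mult; simpl; field; repeat split; lra.
Qed.

Fixpoint theta_derive (t : R) (r N m j : nat) (y : R) : R :=
  match N with
  | O => theta_monomial t r m j y
  | S k => ((INR r * INR j - INR m) * theta_derive t r k (S m) j y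
            - INR r * theta_derive t r k (S m) (S j) y)%R
  end.

Lemma is_derive_theta_derive (t : R) (r N m j : nat) (y : R) :
  (0 < t)%R -> (0 < y)%R ->
  is_derive (theta_derive t r N m j) y (theta_derive t r (S N) m j y).
Proof.
  intros Ht Hy; revert m j; induction N as [|N IH]; intros m j.
  - apply is_derive_theta_monomial; assumption.
  - apply (is_derive_minus (K := R_AbsRing) (V := R_NormedModule)
             (fun y => (INR r * INR j - INR m) * theta_derive t r N (S m) j y)%R
             (fun y => INR r * theta_derive t r N (S m) (S j) y)%R).
    + apply (is_derive_scal (theta_derive t r N (S m) j)), IH.
    + apply (is_derive_scal (theta_derive t r N (S m) (S j))), IH.
Qed.

(** [v ^ i / i!] is one term of the exponential series, hence at most [exp v]. *)
Lemma pow_exp_opp_le (v : R) (i : nat) : (0 <= v)%R -> (v ^ i * exp (- v) <= INR (fact i))%R.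
Proof.
  intros Hv.
  assert (H : (v ^ i / INR (fact i) <= exp v)%R).
  { eapply Rle_trans; [|apply (exp_ge_taylor v i Hv)].
    assert (Hk : forall k, (0 <= v ^ k / INR (fact k))%R).
    { intros k; apply Rdiv_le_0_compat; [apply pow_le, Hv|apply INR_fact_lt_0]. }
    destruct i as [|i]; [apply Rle_refl|].
    rewrite tech5; pose proof (cond_pos_sum _ i Hk); lra. }
  pose proof (INR_fact_lt_0 i) as Hf; pose proof (exp_pos v).
  rewrite exp_Ropp; apply Rmult_le_reg_r with (exp v); [assumption|].
  replace (v ^ i * / exp v * exp v)%R with (v ^ i)%R by (field; lra).
  apply (Rmult_le_compat_r (INR (fact i))) in H; [|lra].
  replace (v ^ i / INR (fact i) * INR (fact i))%R with (v ^ i)%R in H by (field; lra).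
  lra.
Qed.

(* The derivatives of [exp (- (t * y ^ r))] only involve monomials
   [y ^ (r * j - m)] with [m <= r * j]: the factor [r * j - m] kills the others.
   So a derivative of order [r * A + 2] carries at least [A] factors of [t]. *)
Lemma theta_derive_bound (r N m j A : nat) :
  (0 < r)%nat -> (m <= r * j)%nat -> (m + N = r * A + 2)%nat ->
  exists M, (0 <= M)%R /\ forall t y, (0 < t)%R -> (0 < y)%R ->
    (Rabs (theta_derive t r N m j y) <= M * t ^ A / y ^ 2)%R.
Proof.
  intros Hr; revert m j; induction N as [|N IH]; intros m j Hm HN.
  (* Here [m = r * A + 2 <= r * j] forces [A <= j]. Extracting [A] of the [j] factors [t * y ^ r]
     cancels [y ^ (r * A)] and leaves [t ^ A / y ^ 2]; the exponential absorbs the other factors. *)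
  - assert (HA : (A <= j)%nat) by nia.
    exists (INR (fact (j - A))); split; [apply pos_INR|]; intros t y Ht Hy.
    assert (Hyr : (0 < y ^ r)%R) by (apply pow_lt, Hy).
    assert (HyA : (0 < y ^ (r * A))%R) by (apply pow_lt, Hy).
    assert (Hy2 : (0 < / y ^ 2)%R) by (apply Rinv_0_lt_compat, pow_lt, Hy).
    assert (HtA : (0 < t ^ A)%R) by (apply pow_lt, Ht).
    pose proof (pow_exp_opp_le (t * y ^ r) (j - A) ltac:(nra)) as H.
    cbn [theta_derive]; unfold theta_monomial.
    replace m with (r * A + 2)%nat by lia.
    replace j with (A + (j - A))%nat at 1 by lia.
    rewrite !pow_add, Rpow_mult_distr, <- pow_mult.
    replace (/ (y ^ (r * A) * y ^ 2) *
       (t ^ A * y ^ (r * A) * (t * y ^ r) ^ (j - A) * exp (- (t * y ^ r))))%R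
      with ((t ^ A * / y ^ 2) * ((t * y ^ r) ^ (j - A) * exp (- (t * y ^ r))))%R
      by (field; split; nra).
    rewrite Rabs_pos_eq.
    + replace (INR (fact (j - A)) * t ^ A / y ^ 2)%R
        with ((t ^ A * / y ^ 2) * INR (fact (j - A)))%R by (unfold Rdiv; ring).
      apply Rmult_le_compat_l; [nra|exact H].
    + apply Rmult_le_pos; [nra|].
      apply Rmult_le_pos; [apply pow_le; nra|left; apply exp_pos].
  - destruct (IH (S m) (S j)) as (M2 & HM2 & H2); [lia|lia|].
    assert (H1 : exists M1, (0 <= M1)%R /\ forall t y, (0 < t)%R -> (0 < y)%R ->
              (Rabs ((INR r * INR j - INR m) * theta_derive t r N (S m) j y)
               <= M1 * t ^ A / y ^ 2)%R).
    (* For [m = r * j] the induction hypothesis does not apply to [S m] and [j], but the coefficient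
       is then zero. *)
    { destruct (Nat.eq_dec m (r * j)) as [->|Hne].
      - exists 0%R; split; [lra|]; intros t y _ _.
        rewrite mult_INR; replace (_ * _)%R with 0%R by ring.
        rewrite Rabs_R0; unfold Rdiv; lra.
      - destruct (IH (S m) j) as (M1 & HM1 & H1); [lia|lia|].
        exists (Rabs (INR r * INR j - INR m) * M1)%R; split.
        + apply Rmult_le_pos; [apply Rabs_pos|exact HM1].
        + intros t y Ht Hy; rewrite Rabs_mult; unfold Rdiv; rewrite !Rmult_assoc.
          apply Rmult_le_compat_l; [apply Rabs_pos|].
          specialize (H1 t y Ht Hy); unfold Rdiv in H1; rewrite Rmult_assoc in H1.
          exact H1. }
    destruct H1 as (M1 & HM1 & H1).
    exists (M1 + INR r * M2)%R; pose proof (pos_INR r).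
    split; [nra|]; intros t y Ht Hy; simpl theta_derive.
    specialize (H1 t y Ht Hy); specialize (H2 t y Ht Hy).
    eapply Rle_trans; [apply Rabs_triang|].
    rewrite Rabs_Ropp, (Rabs_mult (INR r)), (Rabs_pos_eq (INR r)) by assumption.
    replace ((M1 + INR r * M2) * t ^ A / y ^ 2)%R
      with (M1 * t ^ A / y ^ 2 + INR r * (M2 * t ^ A / y ^ 2))%R by (unfold Rdiv; ring).
    apply Rplus_le_compat; [exact H1|].
    apply Rmult_le_compat_l; assumption.
Qed.

Definition theta_term (r : nat) (x t : R) (n : nat) : C :=
  RtoC (exp (- (INR n + x) ^ r * t)).

Lemma nablan_theta_bound (r A : nat) (x : R) :
  (0 < r)%nat -> (0 < x)%R ->
  exists M, forall t n, (0 < t)%R ->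
    (Cmod (nablan (r * A + 2) (theta_term r x t) n)
     <= M * t ^ A / (INR n + x) ^ 2)%R.
Proof.
  intros Hr Hx.
  destruct (theta_derive_bound r (r * A + 2) 0 0 A Hr) as (M & HM & H); [lia|lia|].
  exists (2 * M)%R; intros t n Ht; pose proof (INR_shift_pos x n Hx).
  assert (HtA : (0 < t ^ A)%R) by (apply pow_lt, Ht).
  rewrite (nablan_ext _ _ (fun n => RtoC (theta_derive t r 0 0 0 (INR n + x)))).
  2:{ intros k; unfold theta_term; simpl; unfold theta_monomial; simpl.
      rewrite Rinv_1; f_equal; rewrite !Rmult_1_l; f_equal; ring. }
  replace (2 * M * t ^ A / (INR n + x) ^ 2)%R
    with (2 * (M * t ^ A / (INR n + x) ^ 2))%R by (unfold Rdiv; ring).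
  apply (nablan_derive_bound _ (fun i y => RtoC (theta_derive t r i 0 0 y))); [exact Hx| |].
  - intros i y Hy; apply is_cderive_RtoC, is_derive_theta_derive; assumption.
  - intros y Hy; rewrite Cmod_R.
    eapply Rle_trans; [apply H; lra|].
    apply Rmult_le_compat_l; [nra|]; apply inv_sqr_le; lra.
Qed.

Lemma theta_term_vanishes (r : nat) (x t : R) :
  (0 < r)%nat -> (0 < x)%R -> (0 < t)%R -> vanishes (theta_term r x t).
Proof.
  intros Hr Hx Ht.
  pose proof (pow_lt x (pred r) Hx) as Hxr.
  (* From [exp (- v) <= / v] with [v = y ^ r * t], and [y ^ r >= x ^ (r - 1) * y]. *)
  apply vanishes_of_inv_bound with x (/ (x ^ pred r * t))%R; [exact Hx|]; intros n.
  pose proof (INR_shift_pos x n Hx) as Hy; pose proof (pos_INR n).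
  unfold theta_term; rewrite Cmod_R, Rabs_pos_eq by (left; apply exp_pos).
  set (y := (INR n + x)%R) in *.
  assert (Hyr : (x ^ pred r * y <= y ^ r)%R).
  { replace r with (S (pred r)) at 2 by lia; simpl; rewrite Rmult_comm.
    apply Rmult_le_compat_l; [lra|]; apply pow_incr; unfold y; lra. }
  pose proof (Rmult_lt_0_compat _ _ Hxr Hy) as Hxy.
  assert (Hv : (0 < y ^ r * t)%R) by nra.
  pose proof (pow_exp_opp_le (y ^ r * t) 1 ltac:(lra)) as H1.
  rewrite pow_1 in H1; simpl in H1.
  replace (- y ^ r * t)%R with (- (y ^ r * t))%R by ring.
  apply Rle_trans with (/ (y ^ r * t))%R.
  - apply Rmult_le_reg_l with (y ^ r * t)%R; [exact Hv|]; rewrite Rinv_r; lra.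
  - unfold Rdiv; rewrite <- Rinv_mult; apply Rinv_le_contravar; nra.
Qed.

Lemma Csums_theta (p r : nat) (c : nat -> C) (x t : R) :
  (0 < r)%nat -> (0 < x)%R -> (0 < t)%R -> zero_mean p c ->
  forall A, Csums (fun n => c n * theta_term r x t n)
              (regsum p (r * A + 2) c (theta_term r x t)).
Proof.
  intros Hr Hx Ht Hc A; apply Csums_regsum with x; auto using theta_term_vanishes.
  destruct (nablan_theta_bound r A x Hr Hx) as (M & HM).
  exists (M * t ^ A)%R; intros n; apply HM, Ht.
Qed.

Definition exp_coeff (i : nat) : C := RtoC ((-1) ^ i / INR (fact i))%R.

Lemma theta_term_expands (r : nat) (x : R) (n A : nat) :
  expands A (fun t => theta_term r x t n) (fun i => exp_coeff i * monomial x (r * i) n).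
Proof.
  apply expands_power_series with 1%R; [lra|]; intros t _.
  unfold theta_term; rewrite <- Cexp_RtoC.
  eapply Csums_ext; [|apply Csums_Cexp]; intros i.
  unfold exp_term, exp_coeff, monomial.
  rewrite <- RtoC_pow, <- !RtoC_mult; f_equal.
  rewrite Rpow_mult_distr, pow_mult.
  replace (- (INR n + x) ^ r)%R with (-1 * (INR n + x) ^ r)%R by ring.
  rewrite Rpow_mult_distr; unfold Rdiv; ring.
Qed.

Lemma theta_expands (p r : nat) (c : nat -> C) (x : R) :
  (0 < r)%nat -> (0 < x)%R -> zero_mean p c -> forall A,
  expands A (fun t => CSeries (fun n => c n * theta_term r x t n))
    (fun i => exp_coeff i * continuation p c x (RtoC (- INR (r * i)))).
Proof.
  intros Hr Hx Hc A.
  pose (N := (r * S A + 2)%nat).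
  assert (HN : forall i, (i <= A)%nat -> (r * i < N)%nat) by (intros; unfold N; nia).
  apply expands_ext with (fun t => regsum p N c (theta_term r x t))
    (fun i => regsum p N c (fun n => exp_coeff i * monomial x (r * i) n)).
  - exists 1%R; split; [lra|]; intros t Ht; symmetry.
    apply CSeries_unique, Csums_theta; auto; lra.
  - intros i Hi; rewrite (regsum_scal p N x); auto using monomial_decays.
    f_equal; apply continuation_neg_nat; auto.
  - apply regsum_expands with x; auto.
    + intros n; apply theta_term_expands.
    + destruct (nablan_theta_bound r (S A) x Hr Hx) as (M & HM).
      exists M, 1%R; split; [lra|]; intros t n Ht; apply HM; lra.
    + intros i n Hi; rewrite nablan_scal, nablan_monomial by auto; ring.
Qed.

(** * Uniqueness of the continuation, and the generating functions *)

Lemma power_series_real_expands (L : C -> C) (a : nat -> C) (m rho : R) :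
  (0 < rho)%R ->
  (forall z : C, (Cmod (z - RtoC m) < rho)%R ->
     is_pseries (K := C_AbsRing) (V := C_NormedModule) a (z - RtoC m) (L z)) ->
  forall A, expands A (fun u => L (RtoC (m + u))) a.
Proof.
  intros Hr H; apply expands_power_series with rho; [exact Hr|]; intros u Hu.
  assert (E : RtoC (m + u) - RtoC m = RtoC u) by (rewrite RtoC_plus; ring).
  specialize (H (RtoC (m + u))); rewrite E, Cmod_R, Rabs_pos_eq in H by lra.
  specialize (H ltac:(lra)); apply is_pseries_Csums in H.
  revert H; apply Csums_ext; intros k; rewrite <- RtoC_pow; ring.
Qed.

(** Let [m] be the supremum of the real points where the functions differ. They agree to the right
    of [m], so their Taylor coefficients at [m] agree by uniqueness of one-sided expansions; hence
    they agree on an interval around [m], and [m - r] would be a smaller upper bound. *)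
Lemma entire_real_identity (L1 L2 : C -> C) :
  entire L1 -> entire L2 -> (forall s : C, (1 < Re s)%R -> L1 s = L2 s) ->
  forall t : R, L1 (RtoC t) = L2 (RtoC t).
Proof.
  intros H1 H2 Heq t0; apply NNPP; intros Hne.
  destruct (completeness (fun t => L1 (RtoC t) <> L2 (RtoC t))) as (m & Hub & Hlub).
  - exists 1%R; intros t Ht; apply Rnot_lt_le; intros Hlt; apply Ht, Heq, Hlt.
  - exists t0; exact Hne.
  - destruct (H1 (RtoC m)) as (a1 & r1 & Hr1 & S1).
    destruct (H2 (RtoC m)) as (a2 & r2 & Hr2 & S2).
    assert (Ea : forall n, a1 n = a2 n).
    { apply asymptotic_expansion_unique with (fun u => L1 (RtoC (m + u))).
      - apply power_series_real_expands with r1; assumption.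
      - intros A; apply expands_ext with (fun u => L2 (RtoC (m + u))) a2; auto.
        + exists 1%R; split; [lra|]; intros u Hu; symmetry; apply NNPP; intros Hd.
          specialize (Hub _ Hd); lra.
        + apply power_series_real_expands with r2; assumption. }
    pose (r := Rmin r1 r2).
    assert (Hr : (0 < r)%R) by (apply Rmin_glb_lt; assumption).
    assert (Hb : is_upper_bound (fun t => L1 (RtoC t) <> L2 (RtoC t)) (m - r)).
    { intros t Ht; apply Rnot_lt_le; intros Hlt; apply Ht.
      assert (Htm : (t <= m)%R) by (apply Hub, Ht).
      assert (Hd : (Cmod (RtoC t - RtoC m) < r)%R).
      { rewrite <- RtoC_minus, Cmod_R; apply Rabs_def1; lra. }
      pose proof (Rmin_l r1 r2); pose proof (Rmin_r r1 r2); unfold r in *.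
      specialize (S1 (RtoC t) ltac:(lra)); specialize (S2 (RtoC t) ltac:(lra)).
      apply is_pseries_Csums in S1, S2.
      apply Csums_unique with (1 := S1).
      revert S2; apply Csums_ext; intros k; rewrite Ea; reflexivity. }
    specialize (Hlub _ Hb); lra.
Qed.

Lemma expands_mult_id (A : nat) (F : R -> C) (g : nat -> C) :
  expands A F g ->
  expands (S A) (fun t => RtoC t * F t) (fun i => match i with O => 0 | S k => g k end).
Proof.
  intros (M & d & Hd & H); exists M, d; split; [exact Hd|]; intros t Ht.
  change (S (S A)) with (1 + S A)%nat; rewrite Csum_add.
  rewrite (Csum_ext (fun k => _) (fun k => RtoC t * (g k * RtoC (t ^ k)%R)) (S A)).
  2:{ intros k _; simpl; rewrite RtoC_mult; ring. }
  rewrite Csum_scal; simpl (Csum _ 1).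
  match goal with |- (Cmod (_ * ?b - (_ + _ * ?v)) <= _)%R =>
    replace (RtoC t * b - (0 + 0 * 1 + RtoC t * v)) with (RtoC t * (b - v)) by ring end.
  rewrite Cmod_mult, Cmod_R, Rabs_pos_eq by lra.
  replace (M * t ^ (1 + S A))%R with (t * (M * t ^ S A))%R by (simpl; ring).
  apply Rmult_le_compat_l; [lra|auto].
Qed.

(** The last term is absorbed into the error, which is why [t] is kept below [1]. This undoes the
    shift of order caused by [expands_mult_id]. *)
Lemma expands_pred (A : nat) (F : R -> C) (g : nat -> C) :
  expands (S A) F g -> expands A F g.
Proof.
  intros (M & d & Hd & H).
  exists (Rabs M + Cmod (g (S A)))%R, (Rmin d 1); split; [apply Rmin_glb_lt; lra|].
  intros t [Ht0 Ht]; pose proof (Rmin_l d 1); pose proof (Rmin_r d 1).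
  specialize (H t ltac:(lra)).
  assert (Hp : (0 < t ^ S A)%R) by (apply pow_lt, Ht0).
  change (Csum (fun i => g i * RtoC (t ^ i)%R) (S (S A)))
    with (Csum (fun i => g i * RtoC (t ^ i)%R) (S A) + g (S A) * RtoC (t ^ S A)%R) in H.
  match type of H with (Cmod (?a - (?b + ?e)) <= _)%R =>
    replace (a - b) with ((a - (b + e)) + e) by ring end.
  eapply Rle_trans; [apply Cmod_triangle|].
  rewrite Rmult_plus_distr_r; apply Rplus_le_compat.
  - eapply Rle_trans; [exact H|].
    apply Rle_trans with (Rabs M * t ^ S (S A))%R.
    + apply Rmult_le_compat_r; [apply pow_le; lra|apply Rle_abs].
    + apply Rmult_le_compat_l; [apply Rabs_pos|].
      rewrite <- (Rmult_1_l (t ^ S A)); change (t ^ S (S A))%R with (t * t ^ S A)%R.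
      apply Rmult_le_compat_r; lra.
  - rewrite Cmod_mult, Cmod_R, Rabs_pos_eq by lra; apply Rle_refl.
Qed.

(** * Comparison with the Bernoulli and Euler generating functions *)

Lemma exp_coeff_neq_0 (i : nat) : exp_coeff i <> 0.
Proof.
  intros E; apply RtoC_inj in E.
  assert (H : ((-1) ^ i <> 0)%R) by (apply pow_nonzero; lra).
  pose proof (INR_fact_neq_0 i).
  apply H; replace ((-1) ^ i)%R with ((-1) ^ i / INR (fact i) * INR (fact i))%R
    by (field; assumption).
  rewrite E; ring.
Qed.

Lemma exp_coeff_S (i : nat) : exp_coeff (S i) = - (exp_coeff i / RtoC (INR (S i))).
Proof.
  assert (H : INR (S i) <> 0%R) by (apply not_0_INR; lia).
  unfold exp_coeff; rewrite <- RtoC_div, <- RtoC_opp by exact H; f_equal.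
  rewrite fact_simpl, mult_INR; simpl pow.
  field; split; [apply INR_fact_neq_0|exact H].
Qed.

Lemma Cmult_cancel_l (a z w : C) : a <> 0 -> a * z = a * w -> z = w.
Proof.
  intros Ha E; replace z with (a * z / a) by (field; exact Ha).
  rewrite E; field; exact Ha.
Qed.

(** The series is geometric in blocks of length [f]: moving by one block multiplies it by
    [kappa * exp (- f t)]. The value [kappa = 1] yields the Bernoulli denominator and [kappa = -1]
    the Euler one. *)
Lemma theta_closed_form (p f : nat) (c : nat -> C) (kappa : C) (x t : R) :
  (0 < x)%R -> (0 < t)%R -> zero_mean p c ->
  (forall n, c (f + n)%nat = kappa * c n) ->
  CSeries (fun n => c n * theta_term 1 x t n)
    * (1 - kappa * RtoC (exp (- (INR f * t)))) =
  Csum (fun n => c n * theta_term 1 x t n) f.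
Proof.
  intros Hx Ht Hc Hf.
  pose proof (Csums_theta p 1 c x t Nat.lt_0_1 Hx Ht Hc 0) as HS.
  rewrite (CSeries_unique _ _ HS); set (l := regsum _ _ _ _) in *.
  pose proof (Csums_shift _ _ f HS) as H1.
  apply (Csums_scal (kappa * RtoC (exp (- (INR f * t))))) in HS.
  assert (E : l - Csum (fun n => c n * theta_term 1 x t n) f
              = kappa * RtoC (exp (- (INR f * t))) * l).
  { apply Csums_unique with (1 := H1).
    revert HS; apply Csums_ext; intros n; rewrite Hf.
    unfold theta_term; rewrite plus_INR.
    replace (- (INR f + INR n + x) ^ 1 * t)%R
      with (- (INR f * t) + - (INR n + x) ^ 1 * t)%R by ring.
    rewrite exp_plus, RtoC_mult; ring. }
  replace (Csum _ f) with (l - (l - Csum (fun n => c n * theta_term 1 x t n) f)) by ring.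
  rewrite E; ring.
Qed.

Lemma Cexp_theta_term (m : nat) (x t : R) :
  Cexp (RtoC (INR m + x) * RtoC (- t)) = theta_term 1 x t m.
Proof.
  rewrite <- RtoC_mult, Cexp_RtoC; unfold theta_term; do 2 f_equal; ring.
Qed.

Lemma generating_function_sum (f : nat) (u a : nat -> C) (z : C) :
  (0 < f)%nat -> (forall m, u m = z * a m) ->
  sum_n (G := C_AbelianMonoid) u (f - 1) = z * Csum a f.
Proof.
  intros Hf E; rewrite sum_n_Csum; replace (S (f - 1)) with f by lia.
  rewrite <- Csum_scal; apply Csum_ext; auto.
Qed.

(** Evaluation at [- t] supplies the signs that [exp_coeff] carries in the theta expansion. *)
Lemma egf_expands (F : R -> C) (b : nat -> C) (d : R) :
  (0 < d)%R ->
  (forall t, (0 < t < d)%R ->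
     is_pseries (K := C_AbsRing) (V := C_NormedModule)
       (fun n => b n / RtoC (INR (fact n))) (RtoC (- t)) (F t)) ->
  forall A, expands A F (fun n => exp_coeff n * b n).
Proof.
  intros Hd H; apply expands_power_series with d; [exact Hd|]; intros t Ht.
  specialize (H t Ht); apply is_pseries_Csums in H.
  revert H; apply Csums_ext; intros n; unfold exp_coeff.
  pose proof (INR_fact_neq_0 n).
  rewrite <- RtoC_pow; replace (- t)%R with (-1 * t)%R by ring.
  rewrite Rpow_mult_distr, RtoC_mult, RtoC_div by assumption.
  field; intros E; apply RtoC_inj in E; contradiction.
Qed.

Lemma exp_opp_lt_1 (u : R) : (0 < u)%R -> (exp (- u) < 1)%R.
Proof. intros Hu; rewrite <- exp_0; apply exp_increasing; lra. Qed.

Lemma Cexp_RtoC_mult (u t : R) :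
  Cexp (RtoC u * RtoC (- t)) = RtoC (exp (- (u * t))).
Proof. rewrite <- RtoC_mult, Cexp_RtoC; do 2 f_equal; ring. Qed.

Lemma continuation_ext (p : nat) (c d : nat -> C) (x : R) (s : C) :
  (forall n, c n = d n) -> continuation p c x s = continuation p d x s.
Proof. intros H; replace d with c by (apply functional_extensionality, H); reflexivity. Qed.

(** At [- t] the generating function is [t] times the theta series of exponent one. The factor [t]
    shifts the index to [S m], and [exp_coeff_S] turns the shift into the divisor [S m] and the
    minus sign. The conjugation in [is_gen_bernoulli] cancels the one in [conj_character]. *)
Lemma continuation_bernoulli (p f : nat) (chi : Z -> C) (B : nat -> R -> C) (x : R)
    (m : nat) :
  (0 < f)%nat -> (0 < x)%R ->
  zero_mean p (fun n => chi (Z.of_nat n)) ->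
  (forall n, chi (Z.of_nat (f + n)) = chi (Z.of_nat n)) ->
  is_gen_bernoulli f (conj_character chi) B ->
  continuation p (fun n => chi (Z.of_nat n)) x (RtoC (- INR m)) =
  - (B (S m) x / RtoC (INR (S m))).
Proof.
  intros Hf Hx Hc Hper HB.
  set (c := fun n => chi (Z.of_nat n)) in *.
  assert (HfR : (0 < INR f)%R) by (apply lt_0_INR, Hf).
  assert (Hd : (0 < 2 * PI / INR f)%R)
    by (apply Rdiv_lt_0_compat; [pose proof PI_RGT_0; lra|exact HfR]).
  assert (H1 : forall A, expands A
     (fun t => RtoC t * CSeries (fun n => c n * theta_term 1 x t n))
     (fun n => exp_coeff n * B n x)).
  { apply egf_expands with (2 * PI / INR f)%R; [exact Hd|]; intros t Ht.
    specialize (HB x (RtoC (- t))).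
    rewrite Cmod_R, Rabs_Ropp, Rabs_pos_eq in HB by lra; specialize (HB Ht).
    match type of HB with is_pseries _ _ ?s => match goal with |- is_pseries _ _ ?s' =>
      enough (Es : @eq C s s') by (rewrite <- Es; exact HB) end end.
    pose proof (exp_opp_lt_1 (INR f * t) ltac:(nra)) as HQ.
    assert (HQ' : RtoC (exp (- (INR f * t))) - 1 <> 0).
    { rewrite <- RtoC_minus; intros E; apply RtoC_inj in E; lra. }
    transitivity (RtoC (- t) / (RtoC (exp (- (INR f * t))) - 1)
                  * Csum (fun n => c n * theta_term 1 x t n) f).
    - apply generating_function_sum; [exact Hf|]; intros k; unfold conj_character.
      rewrite Cconj_conj, Cexp_theta_term, Cexp_RtoC_mult; unfold c.
      field; exact HQ'.
    - rewrite <- (theta_closed_form p f c 1 x t); auto.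
      + rewrite RtoC_opp; field; exact HQ'.
      + lra.
      + intros n; unfold c; rewrite Hper; ring. }
  assert (H2 := theta_expands p 1 c x Nat.lt_0_1 Hx Hc).
  assert (H3 := asymptotic_expansion_unique _ _ _ H1
                  (fun A => expands_pred _ _ _ (expands_mult_id _ _ _ (H2 A))) (S m)).
  cbv beta iota in H3; rewrite Nat.mul_1_l, exp_coeff_S in H3.
  apply (Cmult_cancel_l (exp_coeff m) _ _ (exp_coeff_neq_0 m)).
  rewrite <- H3; field; intros E0; apply RtoC_inj in E0.
  revert E0; apply not_0_INR; lia.
Qed.

(** At [- t] the generating function is twice the theta series of exponent one, hence the division
    by [2]. The blocks of the closed form have the length [f] over which [c] changes sign, while [p]
    is a period of [c]. *)
Lemma continuation_euler (p f : nat) (chi : Z -> C) (E : nat -> R -> C) (x : R)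
    (m : nat) :
  (0 < f)%nat -> (0 < x)%R ->
  let c := fun n => RtoC ((-1) ^ n)%R * chi (Z.of_nat n) in
  zero_mean p c -> (forall n, c (f + n)%nat = - c n) ->
  is_gen_euler f (conj_character chi) E ->
  continuation p c x (RtoC (- INR m)) = E m x / 2.
Proof.
  intros Hf Hx c Hc Hper HE.
  assert (HfR : (0 < INR f)%R) by (apply lt_0_INR, Hf).
  assert (Hd : (0 < PI / INR f)%R)
    by (apply Rdiv_lt_0_compat; [apply PI_RGT_0|exact HfR]).
  assert (H1 : forall A, expands A
     (fun t => 2 * CSeries (fun n => c n * theta_term 1 x t n))
     (fun n => exp_coeff n * E n x)).
  { apply egf_expands with (PI / INR f)%R; [exact Hd|]; intros t Ht.
    specialize (HE x (RtoC (- t))).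
    rewrite Cmod_R, Rabs_Ropp, Rabs_pos_eq in HE by lra; specialize (HE (proj2 Ht)).
    match type of HE with is_pseries _ _ ?s => match goal with |- is_pseries _ _ ?s' =>
      enough (Es : @eq C s s') by (rewrite <- Es; exact HE) end end.
    pose proof (exp_pos (- (INR f * t))) as HQ.
    assert (HQ' : RtoC (exp (- (INR f * t))) + 1 <> 0).
    { rewrite <- RtoC_plus; intros E0; apply RtoC_inj in E0; lra. }
    transitivity (2 / (RtoC (exp (- (INR f * t))) + 1)
                  * Csum (fun n => c n * theta_term 1 x t n) f).
    - apply generating_function_sum; [exact Hf|]; intros k; unfold conj_character.
      rewrite Cconj_conj, Cexp_theta_term, Cexp_RtoC_mult; unfold c.
      rewrite RtoC_mult; field; exact HQ'.
    - rewrite <- (theta_closed_form p f c (-1) x t); auto; [field; exact HQ'|lra|].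
      intros n; rewrite Hper; ring. }
  assert (H2 := theta_expands p 1 c x Nat.lt_0_1 Hx Hc).
  assert (H3 := asymptotic_expansion_unique _ _ _ H1
                  (fun A => expands_scal A 2 _ _ (H2 A)) m).
  cbv beta in H3; rewrite Nat.mul_1_l in H3.
  apply (Cmult_cancel_l (exp_coeff m) _ _ (exp_coeff_neq_0 m)).
  replace (exp_coeff m * (E m x / 2)) with (exp_coeff m * E m x / 2) by (unfold Cdiv; ring).
  rewrite H3; field; intros E0; apply RtoC_inj in E0; lra.
Qed.

(** * Dirichlet characters *)

Fixpoint list_Csum (l : list C) : C :=
  match l with
  | nil => 0
  | cons z l => z + list_Csum l
  end.

Lemma list_Csum_app (l l' : list C) : list_Csum (l ++ l') = list_Csum l + list_Csum l'.
Proof. induction l as [|z l IH]; simpl; [|rewrite IH]; ring. Qed.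

Lemma list_Csum_permutation (l l' : list C) :
  Permutation l l' -> list_Csum l = list_Csum l'.
Proof.
  induction 1 as [|z l l' _ IH|z w l|l l' l'' _ IH1 _ IH2]; simpl;
    [reflexivity|rewrite IH; reflexivity|ring|congruence].
Qed.

Lemma Csum_list (a : nat -> C) (n : nat) : Csum a n = list_Csum (map a (seq 0 n)).
Proof.
  induction n as [|n IH]; [reflexivity|].
  rewrite seq_S, map_app, list_Csum_app, <- IH; simpl; ring.
Qed.

(** An injective self-map of an initial segment permutes it; lists serve to express this as a
    [Permutation]. *)
Lemma Csum_reindex (a : nat -> C) (sigma : nat -> nat) (n : nat) :
  (forall k, (k < n)%nat -> (sigma k < n)%nat) ->
  (forall j k, (j < n)%nat -> (k < n)%nat -> sigma j = sigma k -> j = k) ->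
  Csum (fun k => a (sigma k)) n = Csum a n.
Proof.
  intros Hlt Hinj; rewrite !Csum_list, <- (map_map sigma a).
  apply list_Csum_permutation, Permutation_map, Permutation_map_same_l.
  - apply FinFun.Injective_map_NoDup_in; [|apply seq_NoDup].
    intros j k Hj Hk; apply in_seq in Hj, Hk; apply Hinj; lia.
  - intros k Hk; apply in_map_iff in Hk; destruct Hk as (j & <- & Hj).
    apply in_seq in Hj; apply in_seq; specialize (Hlt j); lia.
Qed.

Lemma character_periodic (f : nat) (chi : Z -> C) (m k : Z) :
  dirichlet_character f chi -> chi (m + k * Z.of_nat f)%Z = chi m.
Proof.
  intros [_ Hper _ _].
  assert (Hnat : forall (n : nat) m, chi (m + Z.of_nat n * Z.of_nat f)%Z = chi m).
  { induction n as [|n IH]; intros m'; [f_equal; lia|].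
    replace (m' + Z.of_nat (S n) * Z.of_nat f)%Z
      with ((m' + Z.of_nat n * Z.of_nat f) + Z.of_nat f)%Z by lia.
    rewrite Hper; apply IH. }
  destruct (Z_le_gt_dec 0 k) as [Hk|Hk].
  - rewrite <- (Hnat (Z.to_nat k) m); f_equal; rewrite Z2Nat.id; lia.
  - rewrite <- (Hnat (Z.to_nat (- k)) (m + _)%Z); f_equal; rewrite Z2Nat.id; lia.
Qed.

(** Multiplication by the unit [u] permutes the residues modulo [f], so the sum is fixed by the
    factor [chi u], which differs from [1]. *)
Lemma character_sum_0 (f : nat) (chi : Z -> C) (u : Z) :
  dirichlet_character f chi -> Z.gcd u (Z.of_nat f) = 1%Z -> chi u <> 1 ->
  Csum (fun n => chi (Z.of_nat n)) f = 0.
Proof.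
  intros Hchi Hu Hne.
  pose proof (dc_modulus_pos _ _ Hchi) as Hf.
  pose (sigma := fun n => Z.to_nat ((u * Z.of_nat n) mod Z.of_nat f)).
  assert (Hmod : forall z, (0 <= z mod Z.of_nat f < Z.of_nat f)%Z)
    by (intros z; apply Z.mod_pos_bound; lia).
  assert (Hs : forall n, Z.of_nat (sigma n) = ((u * Z.of_nat n) mod Z.of_nat f)%Z)
    by (intros n; apply Z2Nat.id, Hmod).
  assert (E : chi u * Csum (fun n => chi (Z.of_nat n)) f
              = Csum (fun n => chi (Z.of_nat n)) f).
  { rewrite <- Csum_scal, <- (Csum_reindex (fun n => chi (Z.of_nat n)) sigma).
    - apply Csum_ext; intros n _; rewrite Hs, <- (dc_mult _ _ Hchi).
      rewrite Z.mod_eq by lia; symmetry.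
      rewrite <- (character_periodic f chi (u * Z.of_nat n)
                    (- (u * Z.of_nat n / Z.of_nat f)) Hchi).
      f_equal; ring.
    - intros k _; specialize (Hs k); specialize (Hmod (u * Z.of_nat k)%Z); lia.
    - intros j k Hj Hk Hjk.
      assert (Hdiv : (Z.of_nat f | u * (Z.of_nat j - Z.of_nat k))%Z).
      { apply (f_equal Z.of_nat) in Hjk; rewrite !Hs in Hjk.
        rewrite Z.mul_sub_distr_l; apply Z.mod_divide; [lia|].
        rewrite Zminus_mod, Hjk, Z.sub_diag; apply Z.mod_0_l; lia. }
      apply Z.gauss in Hdiv; [|rewrite Z.gcd_comm; exact Hu].
      destruct Hdiv as [q Hq].
      assert (q = 0)%Z by nia; subst q; lia. }
  set (S0 := Csum _ f) in *.
  apply (Cmult_cancel_l (chi u - 1)).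
  - intros H0; apply Hne; replace (chi u) with (chi u - 1 + 1) by ring; rewrite H0; ring.
  - replace ((chi u - 1) * S0) with (chi u * S0 - S0) by ring; rewrite E; ring.
Qed.

(** A character trivial on all units is induced by the principal character modulo [1]; primitivity
    then gives [f = 1], where every integer is a unit. *)
Lemma primitive_character_nontrivial (f : nat) (chi : Z -> C) :
  primitive_character f chi -> chi <> principal_character ->
  exists u, Z.gcd u (Z.of_nat f) = 1%Z /\ chi u <> 1.
Proof.
  intros [Hchi Hprim] Hne; apply NNPP; intros Hno.
  assert (Hall : forall m, Z.gcd m (Z.of_nat f) = 1%Z -> chi m = 1).
  { intros m Hm; apply NNPP; intros H; apply Hno; exists m; split; assumption. }
  assert (Hprin : dirichlet_character 1 principal_character).
  { split; [lia|reflexivity|intros; unfold principal_character; ring|].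
    intros m; split; intros _; [apply Z.gcd_1_r|].
    intros E; apply RtoC_inj in E; lra. }
  assert (Hf : 1%nat = f)
    by (apply (Hprim 1%nat principal_character); [exists f; lia|exact Hprin|exact Hall]).
  apply Hne, functional_extensionality; intros m; apply Hall.
  rewrite <- Hf; apply Z.gcd_1_r.
Qed.

Lemma pow_opp_1_odd (n : nat) : Nat.Odd n -> ((-1) ^ n = -1)%R.
Proof. intros [k ->]; rewrite pow_add, pow_1_even; ring. Qed.

(** * The coefficient sequence with its sign factor *)

Definition twist (eps : nat) (chi : Z -> C) : nat -> C :=
  fun n => RtoC ((-1) ^ (eps * n))%R * chi (Z.of_nat n).

Lemma twist_2 (chi : Z -> C) (n : nat) : twist 2 chi n = chi (Z.of_nat n).
Proof. unfold twist; rewrite pow_1_even; ring. Qed.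

Lemma twist_1 (chi : Z -> C) (n : nat) :
  twist 1 chi n = RtoC ((-1) ^ n)%R * chi (Z.of_nat n).
Proof. unfold twist; rewrite Nat.mul_1_l; reflexivity. Qed.

Lemma twist_1_shift (f : nat) (chi : Z -> C) (n : nat) :
  dirichlet_character f chi -> Nat.Odd f -> twist 1 chi (f + n)%nat = - twist 1 chi n.
Proof.
  intros Hchi Hf; unfold twist; rewrite !Nat.mul_1_l, pow_add, pow_opp_1_odd by exact Hf.
  rewrite Nat2Z.inj_add, Z.add_comm, (dc_periodic _ _ Hchi), RtoC_mult; ring.
Qed.

(** For even [f] a nonzero [chi n] requires [n] odd, so the sign is [-1] wherever it matters. *)
Lemma twist_1_even (f : nat) (chi : Z -> C) (n : nat) :
  dirichlet_character f chi -> Nat.Even f ->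
  twist 1 chi n = (-1) * chi (Z.of_nat n).
Proof.
  intros Hchi Hf; unfold twist; rewrite Nat.mul_1_l.
  destruct (Nat.Even_or_Odd n) as [Hn|Hn].
  - replace (chi (Z.of_nat n)) with (RtoC 0); [ring|].
    symmetry; apply NNPP; intros H; apply (dc_support _ _ Hchi) in H.
    destruct Hn as [a ->], Hf as [b ->].
    assert (H2 : (2 | Z.gcd (Z.of_nat (2 * a)) (Z.of_nat (2 * b)))%Z).
    { apply Z.gcd_greatest; [exists (Z.of_nat a)|exists (Z.of_nat b)]; lia. }
    rewrite H in H2; destruct H2 as [q Hq]; lia.
  - rewrite pow_opp_1_odd by exact Hn; reflexivity.
Qed.

Lemma character_zero_mean (f : nat) (chi : Z -> C) (u : Z) :
  dirichlet_character f chi -> Z.gcd u (Z.of_nat f) = 1%Z -> chi u <> 1 ->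
  zero_mean f (fun n => chi (Z.of_nat n)).
Proof.
  intros Hchi Hu Hne; split; [apply (dc_modulus_pos _ _ Hchi)|split].
  - intros n; rewrite Nat2Z.inj_add; apply (dc_periodic _ _ Hchi).
  - apply character_sum_0 with u; assumption.
Qed.

Lemma zero_mean_double (p : nat) (c : nat -> C) (z : C) :
  zero_mean p c -> zero_mean (p + p) (fun n => z * c n).
Proof.
  intros (Hp & Hper & Hs); split; [lia|split].
  - intros n; rewrite Nat.add_assoc, !Hper; reflexivity.
  - rewrite Csum_scal, Csum_add, Hs, (Csum_ext _ c); [rewrite Hs; ring|].
    intros k _; rewrite Nat.add_comm; apply Hper.
Qed.

Lemma zero_mean_ext (p : nat) (c d : nat -> C) :
  (forall n, c n = d n) -> zero_mean p c -> zero_mean p d.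
Proof.
  intros E (Hp & Hper & Hs); split; [exact Hp|split].
  - intros n; rewrite <- !E; apply Hper.
  - rewrite <- Hs; apply Csum_ext; intros; symmetry; apply E.
Qed.

(* For odd [f] the period of [(-1) ^ n * chi n] is [2 * f], not [f]; doubling the
   period in all cases gives a uniform statement. *)
Lemma twist_zero_mean (f eps : nat) (chi : Z -> C) :
  primitive_character f chi -> chi <> principal_character ->
  (eps = 1%nat \/ eps = 2%nat) -> zero_mean (f + f) (twist eps chi).
Proof.
  intros Hprim Hne Heps.
  destruct (primitive_character_nontrivial f chi Hprim Hne) as (u & Hu & Hu1).
  destruct Hprim as [Hchi _].
  pose proof (character_zero_mean f chi u Hchi Hu Hu1) as H0.
  destruct Heps as [-> | ->].
  - destruct (Nat.Even_or_Odd f) as [Hf|Hf].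
    + apply zero_mean_ext with (2 := zero_mean_double f _ (-1) H0).
      intros n; symmetry; apply twist_1_even with f; assumption.
    + split; [pose proof (dc_modulus_pos _ _ Hchi); lia|split].
      * intros n; replace (n + (f + f))%nat with (f + (f + n))%nat by lia.
        rewrite !(twist_1_shift f) by assumption; ring.
      * rewrite Csum_add, (Csum_ext (fun k => twist 1 chi (f + k)%nat)
                             (fun k => (-1) * twist 1 chi k)).
        -- rewrite Csum_scal; ring.
        -- intros k _; rewrite (twist_1_shift f) by assumption; ring.
  - apply zero_mean_ext with (2 := zero_mean_double f _ 1 H0).
    intros n; rewrite twist_2; ring.
Qed.

Local Close Scope C_scope.

Theorem theorem3p1 :
  forall (f : nat) (chi : Z -> C) (r : nat) (b : R) (eps : nat),
    primitive_character f chi ->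
    chi <> principal_character ->
    (0 < r)%nat ->
    (0 < b)%R ->
    (eps = 1%nat \/ eps = 2%nat) ->
    (exists L : C -> C, is_L_continuation r eps b chi L) /\
    forall L : C -> C, is_L_continuation r eps b chi L ->
      asymptotic_expansion
        (fun theta : R => G eps chi theta b r)
        (fun n : nat =>
           Cmult (RtoC ((-1) ^ n / INR (fact n))%R)
                 (L (RtoC (- (INR r * INR n))%R))) /\
      ((b < INR r)%R ->
       forall n : nat,
         (eps = 1%nat -> Nat.Odd f ->
          forall E : nat -> R -> C, is_gen_euler f (conj_character chi) E ->
            L (RtoC (- (INR r * INR n))%R) =
            Cmult (RtoC (INR r / 2)%R) (E (r * n)%nat (b / INR r)%R)) /\
         (eps = 2%nat ->
          forall B : nat -> R -> C, is_gen_bernoulli f (conj_character chi) B ->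
            L (RtoC (- (INR r * INR n))%R) =
            Copp (Cmult (RtoC (INR r))
                    (Cdiv (B (r * n + 1)%nat (b / INR r)%R)
                          (RtoC (INR (r * n + 1))))))).
Proof.
  intros f chi r b eps Hprim Hne Hr Hb Heps.
  assert (Hc := twist_zero_mean f eps chi Hprim Hne Heps).
  destruct Hprim as [Hchi _].
  pose proof (dc_modulus_pos _ _ Hchi) as Hf.
  pose (x := b / INR r).
  assert (HrR : 0 < INR r) by (apply lt_0_INR, Hr).
  assert (Hx : 0 < x) by (apply Rdiv_lt_0_compat; assumption).
  pose (L0 := fun s => Cmult (RtoC (INR r)) (continuation (f + f) (twist eps chi) x s)).
  assert (HL0 : is_L_continuation r eps b chi L0).
  { split; [apply continuation_entire; assumption|].
    intros s Hs; unfold L0; rewrite continuation_CSeries by assumption; reflexivity. }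
  split; [exists L0; exact HL0|]; intros L [HL HLs].
  (* The arguments [- r n] are real, so agreement along the real axis transfers the values of [L0]
     to an arbitrary continuation. *)
  assert (HLL0 : forall n, L (RtoC (- (INR r * INR n))) =
            Cmult (RtoC (INR r))
              (continuation (f + f) (twist eps chi) x (RtoC (- INR (r * n))))).
  { intros n; rewrite mult_INR.
    apply (entire_real_identity L L0 HL (proj1 HL0)).
    intros s Hs; rewrite HLs by exact Hs; symmetry; apply HL0, Hs. }
  split.
  - apply asymptotic_expansion_expands; intros A.
    apply expands_ext with (3 := expands_scal A (RtoC (INR r)) _ _
                                   (theta_expands (f + f) r (twist eps chi) x Hr Hx Hc A)).
    + exists 1; split; [lra|]; intros t _; reflexivity.
    + intros i _; rewrite HLL0; unfold exp_coeff; ring.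
  - intros _ n; rewrite HLL0; split.
    + intros -> Hodd E HE.
      rewrite (continuation_ext _ _ _ _ _ (twist_1 chi)).
      rewrite (continuation_euler (f + f) f chi E x (r * n)); auto.
      * unfold x, Cdiv; rewrite RtoC_div by lra; field.
      * apply zero_mean_ext with (2 := Hc); apply twist_1.
      * intros k; rewrite <- !twist_1; apply twist_1_shift; assumption.
    + intros -> B HB.
      rewrite (continuation_ext _ _ _ _ _ (twist_2 chi)).
      rewrite (continuation_bernoulli (f + f) f chi B x (r * n)); auto.
      * rewrite Nat.add_1_r; unfold x; ring.
      * apply zero_mean_ext with (2 := Hc); apply twist_2.
      * intros k; rewrite Nat2Z.inj_add, Z.add_comm; apply (dc_periodic _ _ Hchi).
Qed.
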